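(* Let $\mathfrak g\neq 0$ be a Lie algebra endowed with a semisimple abelian complex structure $J$. Then there exist $p,q\ge 0$, $p+q\ge 1$, such that $$\mathfrak g=\mathfrak{aff}(\mathbb R)^p\oplus\mathfrak{aff}(\mathbb C)^q .$$ In particular: 1. there exist a $J$-invariant subalgebra $\mathfrak g_+$ and a $J$-invariant subspace $\mathfrak g_-$ such that $$\mathfrak g=\mathfrak g_+\oplus\mathfrak g_-,\quad [\mathfrak g_+,\mathfrak g_+]\subseteq\mathfrak g_+,\quad [\mathfrak g_+,\mathfrak g_-]\subseteq\mathfrak g_-,\quad [\mathfrak g_-,\mathfrak g_-]\subseteq\mathfrak g_+ ;$$ as a consequence, there exists an involution $s\in\mathrm{Aut}(\mathfrak g,J)$ such that $B^{1,1}_s(X,Y):=B^{1,1}(X,sY)$ defines a Hermitian metric on $\mathfrak g$; 2. (for these $\mathfrak g_\pm$ and $s$) $\mathrm{ad}_{JX}^{t_s}=\pm\,\mathrm{ad}_{JX}$ for all $X\in\mathfrak g_\pm\cap\mathfrak g'$, where $(\cdot)^{t_s}$ denotes the transpose with respect to $B^{1,1}_s$.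
   Context: All Lie algebras are finite-dimensional and real; $\mathfrak g'=[\mathfrak g,\mathfrak g]$. A complex structure on $\mathfrak g$ is $J\in\mathrm{End}(\mathfrak g)$ with $J^2=-\mathrm{Id}$ and $[X,Y]+J[JX,Y]+J[X,JY]-[JX,JY]=0$ for all $X,Y$; it is abelian if $[JX,JY]=[X,Y]$ for all $X,Y$. $\mathfrak g$ is $J$-solvable if the series $\mathfrak g^{[0]}(J)=\mathfrak g$, $\mathfrak g^{[j+1]}(J)=[\mathfrak g^{[j]}(J),\mathfrak g^{[j]}(J)]+J[\mathfrak g^{[j]}(J),\mathfrak g^{[j]}(J)]$ reaches $0$. $J$ is semisimple if $\mathfrak g$ has no non-zero $J$-invariant ideals that are $J$-solvable (for the restricted complex structure). $B(X,Y)=\mathrm{tr}(\mathrm{ad}_X\mathrm{ad}_Y)$ and $B^{1,1}(X,Y)=\frac12(B(X,Y)+B(JX,JY))$. $\mathrm{Aut}(\mathfrak g,J)$ is the group of Lie algebra automorphisms commuting with $J$; an involution satisfies $s^2=\mathrm{Id}$. A Hermitian metric is a positive definite symmetric bilinear form invariant under $J$. $\mathfrak{aff}(\mathbb R)$ has basis $X,JX$ with $[JX,X]=X$; $\mathfrak{aff}(\mathbb C)$ has real basis $X,JX,Y,JY$ with $[JX,X]=X$, $[JX,Y]=[JY,X]=Y$, $[JY,Y]=-X$, $[X,Y]=[JX,JY]=0$, both with the indicated complex structure. Exponents denote direct sums of copies, and the displayed equality for $\mathfrak g$ is understood up to holomorphic Lie algebra isomorphism. *)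

(* Defs.v *)
From HB Require Import structures.
From mathcomp Require Import all_boot all_order all_algebra.
From mathcomp Require Import ring.

Set Implicit Arguments.
Unset Strict Implicit.
Unset Printing Implicit Defensive.

Import Order.TTheory GRing.Theory Num.Theory.
Local Open Scope ring_scope.

HB.mixin Record Vector_isLieAlgebra (F : fieldType) L of Vector F L := {
  lie : L -> L -> L;
  lie_linear_l : forall y, linear (lie^~ y);
  lie_linear_r : forall x, linear (lie x);
  liexx : forall x, lie x x = 0;
  lie_jacobi : forall x y z,
    lie x (lie y z) + lie y (lie z x) + lie z (lie x y) = 0
}.

#[short(type="lieAlgType")]
HB.structure Definition LieAlgebra (F : fieldType) :=
  {L of Vector_isLieAlgebra F L & Vector F L}.

Notation "[lie x , y ]" := (lie x y)
  (at level 0, x at level 99, format "[lie  x ,  y ]") : ring_scope.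

Section LieTheory.
Variables (F : fieldType) (L : lieAlgType F).
Implicit Types (x y z : L) (U V W : {vspace L}) (J : 'End(L)).

HB.instance Definition _ x :=
  GRing.isLinear.Build F L L _ (@lie F L x) (lie_linear_r x).

Definition ad x : 'End(L) := linfun (@lie F L x).

Lemma adE x y : ad x y = [lie x, y].
Proof. by rewrite lfunE. Qed.

(* [U, V]: the span of the brackets, as for prodv in falgebra *)
Definition lie_vs U V : {vspace L} :=
  <<[seq [lie u, v] | u <- vbasis U, v <- vbasis V]>>%VS.

Lemma lie_vsP U V W :
  reflect (forall u v, u \in U -> v \in V -> [lie u, v] \in W)
          (lie_vs U V <= W)%VS.
Proof.
apply: (iffP idP) => [sUVW u v Uu Vv | sUVW]; last first.
  apply/span_subvP=> _ /allpairsP[[u v] /= [Uu Vv ->]].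
  by apply: sUVW; apply: vbasis_mem.
apply: (subvP sUVW).
rewrite (coord_vbasis Vv) linear_sum memv_suml // => j _.
rewrite linearZ memvZ //= (coord_vbasis Uu).
set v' := (vbasis V)`_j.
pose l : L -> L := lie^~ v'.
pose Hl := GRing.isLinear.Build F L L _ l (lie_linear_l v').
pose l' : {linear L -> L} := HB.pack l Hl.
rewrite -[X in X \in _]/(l' _) linear_sum memv_suml // => i _.
rewrite linearZ memvZ //= memv_span //.
by apply: allpairs_f; apply: mem_nth; rewrite size_tuple.
Qed.

Definition lie_ideal U := (lie_vs fullv U <= U)%VS.

Definition lie_subalgebra U := (lie_vs U U <= U)%VS.

Definition lftrace (f : 'End(L)) : F := \tr (passmx.mxof (vbasis {:L}) (vbasis {:L}) f).

Definition killing x y : F := lftrace (ad x \o ad y)%VF.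

Definition complex_structure J :=
  (forall x, J (J x) = - x) /\
  (forall x y,
     [lie x, y] + J [lie J x, y] + J [lie x, J y] - [lie J x, J y] = 0).

Definition abelian_complex_structure J :=
  complex_structure J /\ forall x y, [lie J x, J y] = [lie x, y].

Definition J_invariant J U := (J @: U <= U)%VS.

(* When U is a J-invariant subalgebra, this is the series of U for the
   restriction of J to U. *)
Fixpoint J_series J U (n : nat) : {vspace L} :=
  if n is n'.+1 then
    let V := J_series J U n' in (lie_vs V V + J @: lie_vs V V)%VS
  else U.

Definition J_solvable J U := exists n, J_series J U n = 0%VS.

Definition J_semisimple J :=
  forall U, lie_ideal U -> J_invariant J U -> J_solvable J U -> U = 0%VS.

Definition killing11 J x y : F :=
  2^-1 * (killing x y + killing (J x) (J y)).

Definition killing11_twist J (s : 'End(L)) x y : F := killing11 J x (s y).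

End LieTheory.

Section LieMorphisms.
Variables (F : fieldType) (L1 L2 : lieAlgType F).

Definition holomorphic_lie_iso (J1 : 'End(L1)) (J2 : 'End(L2))
    (f : 'Hom(L1, L2)) :=
  [/\ bijective f,
      forall x y, f [lie x, y] = [lie f x, f y] &
      forall x, f (J1 x) = J2 (f x)].

Definition holomorphic_lie_isomorphic (J1 : 'End(L1)) (J2 : 'End(L2)) :=
  exists f : 'Hom(L1, L2), holomorphic_lie_iso J1 J2 f.

End LieMorphisms.

Definition holomorphic_lie_aut (F : fieldType) (L : lieAlgType F)
  (J s : 'End(L)) := holomorphic_lie_iso J J s.

Section Metrics.
Variables (R : realFieldType) (V : vectType R).
Implicit Types (h : V -> V -> R) (J A : 'End(V)).

Definition hermitian_metric J h :=
  [/\ forall x, scalar (h x) /\ scalar (h^~ x),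
      forall x y, h x y = h y x,
      forall x, x != 0 -> 0 < h x x &
      forall x y, h (J x) (J y) = h x y].

(* A' is the transpose of A with respect to h *)
Definition is_transpose h A A' := forall x y, h (A' x) y = h x (A y).

Lemma is_transpose_uniq J h A A1 A2 : hermitian_metric J h ->
  is_transpose h A A1 -> is_transpose h A A2 -> A1 = A2.
Proof.
case=> hlin _ hpos _ tA1 tA2; apply/lfunP=> x; apply/eqP.
rewrite -subr_eq0; apply: contraT => /hpos.
set d := _ - _; have [_ hl] := hlin d.
suff -> : h d d = 0 by rewrite ltxx.
by rewrite {1}/d addrC -scaleN1r hl tA1 tA2 mulN1r addNr.
Qed.

End Metrics.

Section DirectSum.
Variables (F : fieldType) (L1 L2 : lieAlgType F).

Definition lie_pair (x y : L1 * L2) : L1 * L2 :=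
  ([lie x.1, y.1], [lie x.2, y.2]).

Fact lie_pair_linear_l y : linear (lie_pair^~ y).
Proof. by move=> a u v; congr (_, _); apply: lie_linear_l. Qed.

Fact lie_pair_linear_r x : linear (lie_pair x).
Proof. by move=> a u v; congr (_, _); apply: lie_linear_r. Qed.

Fact lie_pairxx x : lie_pair x x = 0.
Proof. by congr (_, _); apply: liexx. Qed.

Fact lie_pair_jacobi x y z :
  lie_pair x (lie_pair y z) + lie_pair y (lie_pair z x)
    + lie_pair z (lie_pair x y) = 0.
Proof. by congr (_, _); apply: lie_jacobi. Qed.

HB.instance Definition _ := Vector_isLieAlgebra.Build F (L1 * L2)%type
  lie_pair_linear_l lie_pair_linear_r lie_pairxx lie_pair_jacobi.

Variables (J1 : 'End(L1)) (J2 : 'End(L2)).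

Definition J_pair_fun (x : L1 * L2) : L1 * L2 := (J1 x.1, J2 x.2).

Fact J_pair_linear : linear J_pair_fun.
Proof. by move=> a u v; congr (_, _); apply: linearP. Qed.

HB.instance Definition _ :=
  GRing.isLinear.Build F (L1 * L2)%type (L1 * L2)%type _
    J_pair_fun J_pair_linear.

Definition J_pair : 'End((L1 * L2)%type) := linfun J_pair_fun.

Lemma J_pairE x : J_pair x = (J1 x.1, J2 x.2).
Proof. by rewrite lfunE. Qed.

End DirectSum.

Section Power.
Variables (F : fieldType) (L : lieAlgType F) (I : finType).

Definition lie_ffun (x y : {ffun I -> L}) : {ffun I -> L} :=
  [ffun i => [lie x i, y i]].

Fact lie_ffun_linear_l y : linear (lie_ffun^~ y).
Proof. by move=> a u v; apply/ffunP=> i; rewrite !ffunE lie_linear_l. Qed.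

Fact lie_ffun_linear_r x : linear (lie_ffun x).
Proof. by move=> a u v; apply/ffunP=> i; rewrite !ffunE lie_linear_r. Qed.

Fact lie_ffunxx x : lie_ffun x x = 0.
Proof. by apply/ffunP=> i; rewrite !ffunE liexx. Qed.

Fact lie_ffun_jacobi x y z :
  lie_ffun x (lie_ffun y z) + lie_ffun y (lie_ffun z x)
    + lie_ffun z (lie_ffun x y) = 0.
Proof. by apply/ffunP=> i; rewrite !ffunE lie_jacobi. Qed.

HB.instance Definition _ := Vector_isLieAlgebra.Build F {ffun I -> L}
  lie_ffun_linear_l lie_ffun_linear_r lie_ffunxx lie_ffun_jacobi.

Variable J : 'End(L).

Definition J_ffun_fun (x : {ffun I -> L}) : {ffun I -> L} :=
  [ffun i => J (x i)].

Fact J_ffun_linear : linear J_ffun_fun.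
Proof. by move=> a u v; apply/ffunP=> i; rewrite !ffunE linearP. Qed.

HB.instance Definition _ :=
  GRing.isLinear.Build F {ffun I -> L} {ffun I -> L} _
    J_ffun_fun J_ffun_linear.

Definition J_ffun : 'End({ffun I -> L}) := linfun J_ffun_fun.

Lemma J_ffunE x i : J_ffun x i = J (x i).
Proof. by rewrite lfunE ffunE. Qed.

End Power.

Fact regular_scaleE (F : fieldType) (k x : F) : k *: (x : F^o) = k * x.
Proof. by []. Qed.

Local Ltac coord_ring := rewrite /= ?regular_scaleE;
  match goal with |- @eq (GRing.regular ?T) ?a ?b => change (@eq T a b) end;
  ring.

(* aff(R): the pair (a, b) stands for a X + b JX. *)
Definition affR (F : fieldType) : Type := (F^o * F^o)%type.

HB.instance Definition _ (F : fieldType) := Vector.on (affR F).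

Section AffR.
Variable F : fieldType.

Definition affR_lie (x y : affR F) : affR F :=
  (x.2 * y.1 - x.1 * y.2, 0).

Fact affR_lie_linear_l y : linear (affR_lie^~ y).
Proof.
by move=> a [u1 u2] [v1 v2]; congr (_, _); coord_ring.
Qed.

Fact affR_lie_linear_r x : linear (affR_lie x).
Proof.
by move=> a [u1 u2] [v1 v2]; congr (_, _); coord_ring.
Qed.

Fact affR_liexx x : affR_lie x x = 0.
Proof. by congr (_, _); coord_ring. Qed.

Fact affR_lie_jacobi x y z :
  affR_lie x (affR_lie y z) + affR_lie y (affR_lie z x)
    + affR_lie z (affR_lie x y) = 0.
Proof. by congr (_, _); coord_ring. Qed.

HB.instance Definition _ := Vector_isLieAlgebra.Build F (affR F)
  affR_lie_linear_l affR_lie_linear_r affR_liexx affR_lie_jacobi.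

Definition affR_J_fun (x : affR F) : affR F := (- x.2, x.1).

Fact affR_J_linear : linear affR_J_fun.
Proof.
by move=> a [u1 u2] [v1 v2]; congr (_, _); coord_ring.
Qed.

HB.instance Definition _ :=
  GRing.isLinear.Build F (affR F) (affR F) _ affR_J_fun affR_J_linear.

Definition affR_J : 'End(affR F) := linfun affR_J_fun.

Definition affR_X : affR F := (1, 0).

Lemma affR_relations : [lie affR_J affR_X, affR_X] = affR_X.
Proof.
by rewrite lfunE; congr (_, _); rewrite /= ?oppr0 ?mul0r ?mulr1 ?subr0.
Qed.

Lemma affR_J_abelian : abelian_complex_structure affR_J.
Proof.
by split; [split=> [[a b] | [a b] [c d]] | move=> [a b] [c d]];
   rewrite !lfunE; congr (_, _); coord_ring.
Qed.

End AffR.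

(* aff(C): the tuple (a, b, c, d) stands for a X + b JX + c Y + d JY. *)
Definition affC (F : fieldType) : Type := (F^o * F^o * F^o * F^o)%type.

HB.instance Definition _ (F : fieldType) := Vector.on (affC F).

Section AffC.
Variable F : fieldType.

Definition affC_lie (x y : affC F) : affC F :=
  let: (a, b, c, d) := x in
  let: (a', b', c', d') := y in
  ((b * a' - a * b') - (d * c' - c * d'), 0,
   (b * c' - c * b') + (d * a' - a * d'), 0).

Fact affC_lie_linear_l y : linear (affC_lie^~ y).
Proof.
move: y => [[[a' b'] c'] d'] k [[[a b] c] d] [[[a1 b1] c1] d1].
by congr (_, _, _, _); coord_ring.
Qed.

Fact affC_lie_linear_r x : linear (affC_lie x).
Proof.
move: x => [[[a' b'] c'] d'] k [[[a b] c] d] [[[a1 b1] c1] d1].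
by congr (_, _, _, _); coord_ring.
Qed.

Fact affC_liexx x : affC_lie x x = 0.
Proof.
by move: x => [[[a b] c] d]; congr (_, _, _, _); coord_ring.
Qed.

Fact affC_lie_jacobi x y z :
  affC_lie x (affC_lie y z) + affC_lie y (affC_lie z x)
    + affC_lie z (affC_lie x y) = 0.
Proof.
move: x y z => [[[a b] c] d] [[[a1 b1] c1] d1] [[[a2 b2] c2] d2].
by congr (_, _, _, _); coord_ring.
Qed.

HB.instance Definition _ := Vector_isLieAlgebra.Build F (affC F)
  affC_lie_linear_l affC_lie_linear_r affC_liexx affC_lie_jacobi.

Definition affC_J_fun (x : affC F) : affC F :=
  let: (a, b, c, d) := x in (- b, a, - d, c).

Fact affC_J_linear : linear affC_J_fun.
Proof.
move=> k [[[a b] c] d] [[[a1 b1] c1] d1].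
by congr (_, _, _, _); coord_ring.
Qed.

HB.instance Definition _ :=
  GRing.isLinear.Build F (affC F) (affC F) _ affC_J_fun affC_J_linear.

Definition affC_J : 'End(affC F) := linfun affC_J_fun.

Definition affC_X : affC F := (1, 0, 0, 0).
Definition affC_Y : affC F := (0, 0, 1, 0).

Lemma affC_relations :
  let X := affC_X in let Y := affC_Y in let J := affC_J in
  [/\ [lie J X, X] = X, [lie J X, Y] = Y /\ [lie J Y, X] = Y,
      [lie J Y, Y] = - X, [lie X, Y] = 0 & [lie J X, J Y] = 0].
Proof.
by split; try split; rewrite ?lfunE; congr (_, _, _, _); coord_ring.
Qed.

Lemma affC_J_abelian : abelian_complex_structure affC_J.
Proof.
by split; [split=> [[[[a b] c] d] | [[[a b] c] d] [[[a1 b1] c1] d1]]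
          | move=> [[[a b] c] d] [[[a1 b1] c1] d1]];
   rewrite !lfunE; congr (_, _, _, _); coord_ring.
Qed.

End AffC.

(* aff(R)^p (+) aff(C)^q *)
Definition aff_sum (F : fieldType) (p q : nat) : lieAlgType F :=
  ({ffun 'I_p -> affR F} * {ffun 'I_q -> affC F})%type.

Definition aff_sum_J (F : fieldType) (p q : nat) : 'End(aff_sum F p q) :=
  J_pair (J_ffun 'I_p (affR_J F)) (J_ffun 'I_q (affC_J F)).

(* Main.v *)
Require Import Defs.
From HB Require Import structures.
From mathcomp Require Import all_boot all_order all_algebra.
From mathcomp Require Import ring lra boolp reals.
From mathcomp Require complex.

Set Implicit Arguments.
Unset Strict Implicit.
Unset Printing Implicit Defensive.

Import Order.TTheory GRing.Theory Num.Theory.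
Local Open Scope ring_scope.

(** The bracket of vectors of types (1,0) and (0,1) spans the complexified
    derived algebra because [J] is abelian, and since the two types form abelian
    subalgebras, Itô's argument shows that [A = g'] is abelian.  Hence
    [x * y = [J x, y]] is a commutative associative product on [A].  A [g]-stable
    subspace [K] of [A] with [K * K = 0] generates the [J]-solvable ideal
    [K + J K], so semisimplicity makes [A] a reduced finite-dimensional real
    algebra: it has a unit [e] and is a product of copies of the reals and of the
    complex numbers.  Because [J] is semisimple the centre vanishes, and
    [z - [J z, e] - J [z, e]] is central, so [g] is the direct sum of [A] and
    [J A]; this is the asserted product of copies of aff(R) and aff(C).
    The involution [s] is complex conjugation on every copy of the complex
    numbers: in the resulting coordinates the twisted form [B^{1,1}_s] is a
    weighted sum of squares, and the transpose of [ad (J x)] is [ad (J (s x))]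
    for [x] in [g']. *)

Local Ltac coord_ring := rewrite /= ?regular_scaleE;
  match goal with |- @eq (GRing.regular ?T) ?a ?b => change (@eq T a b) end;
  ring.

(* Reduces identities between vectors to scalar ones, to which [ring] applies. *)
Lemma eq_scalars (F : fieldType) (V : vectType F) (u v : V) :
  (forall phi : {scalar V}, phi u = phi v) -> u = v.
Proof.
move=> eq_uv; rewrite (coord_vbasis (memvf u)) (coord_vbasis (memvf v)).
by apply: eq_bigr => i _; rewrite (eq_uv (coord (vbasis fullv) i)).
Qed.

(** * Lie algebras with an abelian complex structure *)

Section LieBasics.
Variables (F : fieldType) (L : lieAlgType F).
Implicit Types (x y z : L) (U V W : {vspace L}).

Lemma lieDl x y z : [lie x + y, z] = [lie x, z] + [lie y, z].
Proof. by have := lie_linear_l z 1 x y; rewrite !scale1r. Qed.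

Lemma lie0l z : [lie 0, z] = 0.
Proof. by apply: (addIr [lie 0, z]); rewrite -lieDl addr0 add0r. Qed.

Lemma lieZl a x z : [lie a *: x, z] = a *: [lie x, z].
Proof. by have := lie_linear_l z a x 0; rewrite !(addr0, lie0l). Qed.

Lemma lieNl x z : [lie - x, z] = - [lie x, z].
Proof. by rewrite -scaleN1r lieZl scaleN1r. Qed.

Lemma lieBl x y z : [lie x - y, z] = [lie x, z] - [lie y, z].
Proof. by rewrite lieDl lieNl. Qed.

Lemma lieC x y : [lie x, y] = - [lie y, x].
Proof.
have := liexx (x + y).
by rewrite lieDl !linearD /= !liexx add0r addr0 => /eqP; rewrite addr_eq0 => /eqP.
Qed.

Lemma lieA x y z : [lie [lie x, y], z] = [lie x, [lie y, z]] - [lie y, [lie x, z]].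
Proof.
apply: eq_scalars => phi; have := congr1 phi (lie_jacobi x y z).
rewrite (lieC [lie x, y]) (lieC x z) !linear0 !linearD !linearN /= => h.
by rewrite -[LHS]addr0 -h; ring.
Qed.

Lemma lieAC x y z : [lie [lie x, y], z] = [lie x, [lie y, z]] + [lie [lie x, z], y].
Proof. by rewrite lieA (lieC y [lie x, z]) opprK. Qed.

Lemma lieRA x y z : [lie x, [lie y, z]] = [lie [lie x, y], z] - [lie [lie x, z], y].
Proof. by rewrite (lieAC x y) addrK. Qed.

Lemma lie_vs_mem U V x y : x \in U -> y \in V -> [lie x, y] \in lie_vs U V.
Proof. by move=> Ux Vy; apply: (lie_vsP U V _ (subvv _)). Qed.

End LieBasics.

(** * The derived algebra of an abelian complex structure *)

Section AbelianJ.
Variables (F : numFieldType) (L : lieAlgType F) (J : 'End(L)).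
Implicit Types (x y z : L) (U V W K : {vspace L}).
Hypothesis abJ : abelian_complex_structure J.

Lemma JK x : J (J x) = - x. Proof. by case: abJ => -[]. Qed.

Lemma lieJJ x y : [lie J x, J y] = [lie x, y]. Proof. by case: abJ. Qed.

Lemma lieJl x y : [lie J x, y] = - [lie x, J y].
Proof. by rewrite -(lieJJ x) JK linearN opprK. Qed.

Lemma lieJC x y : [lie J x, y] = [lie J y, x].
Proof. by rewrite lieJl lieC opprK. Qed.

(* With [p x = x - i J x] and [q y = y + i J y] in the complexification,
   [[p x, q y] = p (lieE x y) + q (lieD x y)]. *)
Local Definition lieD x y := [lie x, y] + J [lie J x, y].
Local Definition lieE x y := [lie x, y] - J [lie J x, y].

Lemma lieD_Jl x y : lieD (J x) y = - J (lieD x y).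
Proof. by rewrite /lieD JK lieNl linearN linearD /= JK opprB. Qed.

Lemma lieE_Jr x y : lieE x (J y) = - J (lieE x y).
Proof.
by rewrite /lieE lieJJ lieJl linearN opprK linearD /= JK opprB.
Qed.

Local Ltac vect_ring :=
  apply: eq_scalars => phi; rewrite !(linearD, linearB, linearN) /=; ring.

(** This is the Jacobi identity for [p x1], [p x2], [q y], where [p x1] and [p x2] commute. In real
    terms, the two copies of [[[x1, x2], y]] cancel because [[J x1, J x2] = [x1, x2]]. *)
Lemma lieD_sym x1 x2 y : [lie lieD x1 y, x2] = [lie lieD x2 y, x1].
Proof.
rewrite /lieD !lieDl 2!(lieJl [lie _, _]).
have h u v : [lie [lie u, y], v] = [lie [lie u, v], y] + [lie [lie v, y], u].
  rewrite lieA (lieC u [lie y, v]) (lieC y [lie u, v]) (lieC y v).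
  by rewrite lieNl !opprK addrC.
by rewrite (h x1 x2) (h (J x1) (J x2)) lieJJ; vect_ring.
Qed.

Lemma lieE_sym x y1 y2 : [lie lieE x y1, y2] = [lie lieE x y2, y1].
Proof.
rewrite /lieE !lieBl 2!(lieJl [lie _, _]) !opprK.
rewrite (lieAC x y1 y2) (lieJl x y1) lieNl (lieAC x (J y1) (J y2)) lieJJ.
by rewrite (lieJl x y2) lieNl; vect_ring.
Qed.

(** Turns a bracket with [lieE x y] into iterated brackets, so that for [d = lieD x1 y1] the
    symmetry [lieD_sym] can exchange [x1] and [x]. *)
Lemma lie_lieE d x y :
  [lie d, lieE x y] = [lie [lie d, x], y] + [lie [lie d, J x], J y].
Proof.
rewrite /lieE linearB /= -(lieJJ d (J _)) JK linearN /= opprK !lieRA lieJJ.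
rewrite (lieJl d y) lieNl.
have := lieRA d (J x) (J y); rewrite lieJJ lieRA => h.
apply: eq_scalars => phi; have := congr1 phi h.
by rewrite !(linearD, linearB, linearN) /= => ->; ring.
Qed.

Lemma lie_lieD d x y :
  [lie d, lieD x y] = - ([lie [lie d, y], x] + [lie [lie d, J y], J x]).
Proof.
rewrite /lieD linearD /= -(lieJJ d (J _)) JK linearN /= !lieRA lieJJ.
by rewrite (lieJl d y) lieNl; vect_ring.
Qed.

(** First of Itô's two exchanges: after [lie_lieE] each term is subject to [lieD_sym], and the [J]
    of the second term moves across because [lieD] is conjugate-linear in its first argument. *)
Lemma lieDE_sym x1 x2 y1 y2 :
  [lie lieD x1 y1, lieE x2 y2] = [lie lieD x2 y1, lieE x1 y2].
Proof.
rewrite !lie_lieE (lieD_sym x1 x2); congr (_ + [lie _, _]).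
by rewrite (lieD_sym x1 (J x2)) lieD_Jl lieNl lieJl opprK.
Qed.

Lemma lieED_sym x1 x2 y1 y2 :
  [lie lieE x1 y1, lieD x2 y2] = [lie lieE x1 y2, lieD x2 y1].
Proof.
rewrite !lie_lieD (lieE_sym x1 y1); congr (- (_ + [lie _, _])).
by rewrite (lieE_sym x1 y1) lieE_Jr lieNl lieJl opprK.
Qed.

Lemma lie_lie_J x1 y1 x2 y2 :
  [lie [lie x1, y1], [lie x2, y2]] = [lie [lie J x1, y1], [lie J x2, y2]].
Proof.
(* Exchanging [x1], [x2] in the first summand and [y1], [y2] in the second leaves two opposite
   brackets. *)
have h : [lie lieD x1 y1, lieE x2 y2] + [lie lieE x1 y1, lieD x2 y2] = 0.
  by rewrite lieDE_sym lieED_sym lieC addNr.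
have e : [lie lieD x1 y1, lieE x2 y2] + [lie lieE x1 y1, lieD x2 y2] =
    2 *: ([lie [lie x1, y1], [lie x2, y2]] - [lie [lie J x1, y1], [lie J x2, y2]]).
  rewrite /lieD /lieE !(lieDl, lieNl, linearD, linearN) /= !lieJJ.
  by apply: eq_scalars => phi; rewrite !(linearD, linearN, linearZ) /=; ring.
move/eqP: e; rewrite h eq_sym scaler_eq0 pnatr_eq0 /= subr_eq0.
by move/eqP.
Qed.

(* By [lie_lie_J], exchanging [x1] and [y1] does not change the bracket, while
   antisymmetry changes its sign. *)
Lemma derived_abelian x1 y1 x2 y2 : [lie [lie x1, y1], [lie x2, y2]] = 0.
Proof.
have h := lie_lie_J y1 x1 x2 y2.
rewrite (lieC y1 x1) lieNl (lieJC y1) -lie_lie_J in h.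
apply/eqP; move/eqP: h; rewrite eq_sym -addr_eq0 -mulr2n -scaler_nat.
by rewrite scaler_eq0 pnatr_eq0.
Qed.

Local Notation A := (lie_vs {:L}%VS {:L}%VS).

Lemma derived_mem x y : [lie x, y] \in A.
Proof. by rewrite lie_vs_mem ?memvf. Qed.

Lemma derived_lie0 x y : x \in A -> y \in A -> [lie x, y] = 0.
Proof.
have A_sub z w : (A <= lker (ad [lie z, w]))%VS.
  by apply/lie_vsP=> u v _ _; rewrite memv_ker adE derived_abelian.
move=> Ax Ay; have /subvP/(_ y Ay) : (A <= lker (ad x))%VS.
  apply/lie_vsP=> u v _ _; rewrite memv_ker adE lieC oppr_eq0 -adE.
  by rewrite -memv_ker (subvP (A_sub u v)).
by rewrite memv_ker adE => /eqP.
Qed.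

(** The Jacobi term [[[z, J x], y]] is a bracket of two elements of [A] and vanishes. Thus every
    [ad z] is linear over the product of [A]. *)
Lemma derived_ad_mulC z x y :
  x \in A -> y \in A -> [lie z, [lie J x, y]] = [lie J x, [lie z, y]].
Proof.
move=> Ax Ay; rewrite lieRA (lieC [lie z, y]) opprK.
by rewrite (derived_lie0 (derived_mem _ _) Ay) add0r.
Qed.

(** The operators [ad (J x)] and [ad (J y)] commute since [[J x, J y] = [x, y] = 0]. Together with
    the commutativity [lieJC] this is associativity of the product. *)
Lemma derived_mulCA x y z : x \in A -> y \in A ->
  [lie J x, [lie J y, z]] = [lie J y, [lie J x, z]].
Proof.
move=> Ax Ay; rewrite lieRA (lieC [lie J x, z]) opprK lieJJ.
by rewrite (derived_lie0 Ax Ay) lie0l add0r.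
Qed.

Lemma lie_idealP K :
  reflect (forall z k, k \in K -> [lie z, k] \in K) (lie_ideal K).
Proof.
apply: (iffP (lie_vsP _ _ _)) => h u v; first exact: h (memvf _).
by move=> _; apply: h.
Qed.

Lemma ideal_mul_mem K x y : lie_ideal K -> y \in K -> [lie J x, y] \in K.
Proof. by move=> /lie_idealP h; apply: h. Qed.

Hypothesis J_ss : J_semisimple J.

(** Semisimplicity is applied to [K + J @: K]. As [[z, J l] = - [J z, l]], all brackets with it fall
    in [K]; its own brackets reduce to brackets inside [A] and products in [K], which vanish. *)
Lemma square_zero_ideal K : lie_ideal K -> (K <= A)%VS ->
  {in K &, forall x y, [lie J x, y] = 0} -> K = 0%VS.
Proof.
move=> /lie_idealP idK /subvP KA K0; apply/eqP; rewrite -subv0.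
suff <- : (K + J @: K)%VS = 0%VS by rewrite addvSl.
apply: J_ss.
- apply/lie_idealP=> z _ /memv_addP[k Kk [_ /memv_imgP[l Kl ->] ->]].
  rewrite linearD /= (lieC z (J l)) lieJC.
  by rewrite (subvP (addvSl _ _)) // memvB ?idK.
- apply/subvP=> _ /memv_imgP[_ /memv_addP[k Kk [_ /memv_imgP[l Kl ->] ->]] ->].
  by rewrite linearD /= JK addrC memv_add ?memv_img ?memvN.
- exists 1%N => /=; set V := (K + _)%VS.
  suff -> : lie_vs V V = 0%VS by rewrite limg0 addv0.
  apply/eqP; rewrite -subv0; apply/lie_vsP.
  move=> _ v /memv_addP[k Kk [_ /memv_imgP[l Kl ->] ->]].
  move: v => _ /memv_addP[k' Kk' [_ /memv_imgP[l' Kl' ->] ->]].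
  rewrite memv0 lieDl !linearD /= lieJJ (lieC k (J l')) !K0 //.
  by rewrite !derived_lie0 ?KA // oppr0 !addr0.
Qed.

End AbelianJ.

(** * Real eigenvectors *)

Section RealEigen.
Variable R : rcfType.
Import complex ComplexField.
Local Open Scope complex_scope.

(** Here [a + i b] is a complex eigenvalue of the matrix of [f]. The real and imaginary parts of an
    eigenvector are both annihilated by [(f - a)^2 + b^2], and at least one of them is non-zero. *)
Lemma real_quadratic_eigenvector (V : vectType R) (f : 'End(V)) :
  {:V}%VS != 0%VS -> exists a b v,
    v != 0 /\ f (f v) - (2 * a) *: f v + (a ^+ 2 + b ^+ 2) *: v = 0.
Proof.
rewrite -dimv_eq0 -lt0n => dim_gt0.
pose B := vbasis {:V}; pose M := passmx.mxof B B f.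
have [l /eigenvalueP[w wM w_neq0]] :=
  eigenvalue_closed (map_mx (real_complex R) M) dim_gt0.
have Re_sum n (x : 'I_n -> R[i]) (m : 'I_n -> R) :
    complex.Re (\sum_i x i * (m i)%:C) = \sum_i complex.Re (x i) * m i.
  rewrite (big_morph (@complex.Re R) (id1 := 0) (op1 := +%R)) //; last by case=> ? ? [].
  by apply: eq_bigr => i _; case: (x i) => c d /=; rewrite mulr0 subr0.
have Im_sum n (x : 'I_n -> R[i]) (m : 'I_n -> R) :
    complex.Im (\sum_i x i * (m i)%:C) = \sum_i complex.Im (x i) * m i.
  rewrite (big_morph (@complex.Im R) (id1 := 0) (op1 := +%R)) //; last by case=> ? ? [].
  by apply: eq_bigr => i _; case: (x i) => c d /=; rewrite mulr0 add0r.
pose re := map_mx (@complex.Re R) w; pose im := map_mx (@complex.Im R) w.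
have reM : re *m M = complex.Re l *: re - complex.Im l *: im.
  apply/rowP=> j; have := congr1 (fun X : 'rV_ _ => complex.Re (X 0 j)) wM.
  rewrite !mxE; under eq_bigr do rewrite mxE; rewrite Re_sum.
  under [X in _ -> X = _]eq_bigr do rewrite mxE.
  by move->; case: (l) (w 0 j) => ? ? [].
have imM : im *m M = complex.Re l *: im + complex.Im l *: re.
  apply/rowP=> j; have := congr1 (fun X : 'rV_ _ => complex.Im (X 0 j)) wM.
  rewrite !mxE; under eq_bigr do rewrite mxE; rewrite Im_sum.
  under [X in _ -> X = _]eq_bigr do rewrite mxE.
  by move->; case: (l) (w 0 j) => ? ? [].
pose q (r : 'rV[R]_(\dim {:V})) := (- (2 * complex.Re l)) *: (r *m M)
   + ((complex.Re l ^+ 2 + complex.Im l ^+ 2) *: r + r *m M *m M).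
have q0 r : q r = 0 -> r != 0 -> exists v, v != 0 /\
    f (f v) - (2 * complex.Re l) *: f v
      + (complex.Re l ^+ 2 + complex.Im l ^+ 2) *: v = 0.
  have fE s : f (passmx.vecof B s) = passmx.vecof B (s *m M).
    by apply: passmx.hom_vecof; apply: vbasisP.
  move=> qr r0; exists (passmx.vecof B r); rewrite (passmx.vecof_eq0 (vbasisP _)).
  split=> //; have := congr1 (passmx.vecof B) qr.
  rewrite /q !(passmx.vecof_linear B) -!fE scaleNr addrA addrC addrA => ->.
  by apply/eqP; rewrite (passmx.vecof_eq0 (vbasisP _)).
exists (complex.Re l), (complex.Im l).
case: (eqVneq re 0) => [re0|]; last first.
  apply: q0 => //; rewrite /q reM mulmxBl -!scalemxAl reM imM.
  by apply/rowP=> j; rewrite !mxE; ring.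
case: (eqVneq im 0) => [im0|].
  case/eqP: w_neq0; apply/rowP=> j; rewrite mxE.
  have := congr1 (fun X : 'rV_ _ => X 0 j) re0.
  have := congr1 (fun X : 'rV_ _ => X 0 j) im0.
  by rewrite !mxE; case: (w 0 j) => c d /= -> ->.
apply: q0 => //; rewrite /q imM mulmxDl -!scalemxAl reM imM.
by apply/rowP=> j; rewrite !mxE; ring.
Qed.

End RealEigen.

(** * Minimal ideals of the derived algebra *)

Section Blocks.
Variables (R : rcfType) (L : lieAlgType R) (J : 'End(L)).
Implicit Types (x y z : L) (K M N : {vspace L}).
Hypothesis abJ : abelian_complex_structure J.
Hypothesis J_ss : J_semisimple J.
Local Notation A := (lie_vs {:L}%VS {:L}%VS).

(** By [derived_ad_mulC], multiplication by [x] commutes with every [ad z] on [A]; as in Schur's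
    lemma, its images and kernels are again ideals. *)
Lemma ideal_image x K :
  x \in A -> (K <= A)%VS -> lie_ideal K -> lie_ideal (ad (J x) @: K).
Proof.
move=> Ax /subvP KA /lie_idealP idK; apply/lie_idealP=> z _ /memv_imgP[k Kk ->].
by rewrite adE (derived_ad_mulC abJ) // ?KA // -adE memv_img ?idK.
Qed.

Lemma ideal_ker x K :
  x \in A -> (K <= A)%VS -> lie_ideal K -> lie_ideal (K :&: lker (ad (J x))).
Proof.
move=> Ax /subvP KA /lie_idealP idK; apply/lie_idealP=> z k.
rewrite !memv_cap !memv_ker !adE => /andP[Kk /eqP k0].
by rewrite idK // -(derived_ad_mulC abJ) // ?KA // k0 linear0 /=.
Qed.

Definition minimal_ideal M :=
  [/\ lie_ideal M, M != 0%VS &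
      forall N, lie_ideal N -> (N <= M)%VS -> N != 0%VS -> N = M].

Lemma ex_minimal_ideal K :
  lie_ideal K -> K != 0%VS -> exists2 M, (M <= K)%VS & minimal_ideal M.
Proof.
have [n] := ubnP (\dim K); elim: n K => // n IH K ltKn idK K0.
have [[N [idN NK N0 neNK]]|noN] := pselect
  (exists N, [/\ lie_ideal N, (N <= K)%VS, N != 0%VS & N != K]).
  have [|M MN minM] := IH N _ idN N0; last by exists M => //; apply: subv_trans NK.
  rewrite ltnS in ltKn; apply: leq_trans ltKn; rewrite ltn_neqAle dimvS // andbT.
  by rewrite (dimv_leqif_eq NK).
exists K => //; split=> // N idN NK N0; apply/eqP; apply: contrapT => /negP neNK.
by apply: noN; exists N.
Qed.

Section MinimalIdeal.
Variable M : {vspace L}.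
Hypotheses (MA : (M <= A)%VS) (minM : minimal_ideal M).

Let idM : lie_ideal M. Proof. by case: minM. Qed.
Let memMA := subvP MA.

(** Some [x] in [M] has a non-zero product with an element of [M], so by minimality multiplication
    by [x] is bijective on [M]. The unit is the [e] with [x * e = x]: then [x * (e * z - z) = 0] for
    every [z] in [M]. *)
Lemma minimal_ideal_unit :
  exists e, [/\ e \in M, e != 0 & {in M, forall y, [lie J e, y] = y}].
Proof.
have [_ M0 minN] := minM.
have [x Mx [y My xy0]] : exists2 x, x \in M & exists2 y, y \in M & [lie J x, y] != 0.
  apply: contrapT => noxy; case/eqP: M0; apply: (square_zero_ideal abJ J_ss) => //.
  move=> x y Mx My; apply/eqP; apply: contrapT => /negP xy0.
  by apply: noxy; exists x => //; exists y.
have imM : (ad (J x) @: M)%VS = M.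
  apply: minN; first exact: ideal_image (memMA Mx) MA idM.
    apply/subvP=> _ /memv_imgP[k Mk ->]; rewrite adE.
    exact: ideal_mul_mem.
  apply: contraNneq xy0 => im0.
  by rewrite -memv0 -im0 -adE memv_img.
have kerM : (M :&: lker (ad (J x)))%VS = 0%VS.
  apply/eqP; rewrite -dimv_eq0; have := limg_ker_dim (ad (J x)) M.
  by rewrite imM => /eqP; rewrite -[X in _ == X]add0n eqn_add2r.
have [e Me /esym] : exists2 e, e \in M & x = ad (J x) e.
  by apply/memv_imgP; rewrite imM.
rewrite adE => xe; exists e; split=> // [|z Mz].
  by apply: contraNneq xy0 => e0; rewrite -xe e0 linear0 linear0 lie0l.
apply/eqP; rewrite -subr_eq0 -memv0 -kerM memv_cap memv_ker adE.
rewrite memvB ?(ideal_mul_mem _ _ idM) //= linearB /= subr_eq0.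
rewrite (derived_mulCA abJ) ?memMA // (lieJC abJ x z) (derived_mulCA abJ) ?memMA //.
by rewrite (lieJC abJ e) xe.
Qed.

Variable e : L.
Hypothesis Me : e \in M.
Hypothesis e_unit : {in M, forall y, [lie J e, y] = y}.

(** The annihilator of [y] in [M] is an ideal. If it contains some [z != 0] it is all of [M], hence
    contains [e], and [y = y * e = 0]. *)
Lemma minimal_ideal_domain y z :
  y \in M -> z \in M -> y != 0 -> [lie J y, z] = 0 -> z = 0.
Proof.
move=> My Mz y0 yz0; have [_ _ minN] := minM.
apply/eqP; apply: contraNT y0 => z0.
suff kerM : (M :&: lker (ad (J y)) = M)%VS.
  move: Me; rewrite -kerM memv_cap memv_ker adE => /andP[_].
  by rewrite (lieJC abJ) e_unit.
apply: minN; rewrite ?capvSl //; first exact: ideal_ker (memMA My) MA idM.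
apply: contraNneq z0 => ker0.
by rewrite -memv0 -ker0 memv_cap Mz memv_ker adE yz0 eqxx.
Qed.

(** An eigenvector as in [real_quadratic_eigenvector] shows that a quadratic polynomial [S] in
    multiplication by [x] has a kernel on [M]. This kernel is an ideal, so it is [M], and the
    relation is [S e = 0]. *)
Lemma minimal_ideal_quadratic x : x \in M ->
  exists a b, [lie J x, x] - (2 * a) *: x + (a ^+ 2 + b ^+ 2) *: e = 0.
Proof.
move=> Mx; have [_ M0 minN] := minM.
pose T := ad (J x).
have TM y : y \in M -> T y \in M by move=> My; rewrite adE (ideal_mul_mem _ _ idM).
pose f : 'End(subvs_of M) := linfun (vsproj M \o T \o vsval).
have fE v : vsval (f v) = T (vsval v).
  by rewrite lfunE /= vsprojK // TM // subvsP.
have [|a [b [v [v0 fv]]]] := real_quadratic_eigenvector f.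
  by rewrite -dimv_eq0 dimvf -[dim _]/(\dim M) dimv_eq0.
exists a, b.
pose S : 'End(L) := (T \o T - (2 * a) *: T + (a ^+ 2 + b ^+ 2) *: \1)%VF.
have SE y : S y = T (T y) - (2 * a) *: T y + (a ^+ 2 + b ^+ 2) *: y.
  by rewrite /S !(add_lfunE, opp_lfunE, scale_lfunE, comp_lfunE, id_lfunE).
have SM : (M :&: lker S = M)%VS.
  apply: minN; rewrite ?capvSl //.
    apply/lie_idealP=> z k; rewrite !memv_cap !memv_ker => /andP[Mk /eqP Sk0].
    have Mzk : [lie z, k] \in M by move/lie_idealP: idM; apply.
    rewrite Mzk SE !adE -!(derived_ad_mulC abJ) ?memMA ?(ideal_mul_mem _ _ idM) //.
    move: Sk0; rewrite SE !adE => /(congr1 (fun u => [lie z, u])).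
    by rewrite linear0 linearD linearB !linearZ /= => ->.
  apply: contraNneq v0 => S0; rewrite -(inj_eq (@subvs_inj _ _ _)) linear0.
  rewrite -memv0 -S0 memv_cap subvsP memv_ker SE.
  have := congr1 vsval fv; rewrite linearD linearB !linearZ linear0 /= !fE => ->.
  exact: eqxx.
have : e \in (M :&: lker S)%VS by rewrite SM.
rewrite memv_cap memv_ker SE !adE => /andP[_ /eqP].
by rewrite -(lieJC abJ e) e_unit.
Qed.

(** Frobenius' argument: completing the square, every element of [M] is a multiple of [e] plus an
    element whose square is [- b ^+ 2 *: e]. One with [b != 0], rescaled, gives the imaginary unit
    [j]. *)
Lemma minimal_ideal_RC :
  (M <= <[e]>)%VS \/
  exists2 j, j \in M & [lie J j, j] = - e /\ (M <= <[e]> + <[j]>)%VS.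
Proof.
have [Me1|/subvPn[x Mx xe]] := boolP (M <= <[e]>)%VS; [by left | right].
have sq a y : [lie J (y - a *: e), y - a *: e] =
    [lie J y, y] - (2 * a) *: [lie J e, y] + a ^+ 2 *: [lie J e, e].
  rewrite !(linearD, linearN, linearZ) /= !(lieDl, lieNl, lieZl) (lieJC abJ y e).
  by apply: eq_scalars => phi; rewrite !(linearD, linearN, linearZ) /=; ring.
have quad y : y \in M -> exists a b, [lie J (y - a *: e), y - a *: e] = - b ^+ 2 *: e.
  move=> My; have [a [b h]] := minimal_ideal_quadratic My; exists a, b.
  rewrite sq !e_unit //; apply/eqP; rewrite -subr_eq0 -h; apply/eqP.
  by apply: eq_scalars => phi; rewrite !(linearD, linearN, linearZ) /=; ring.
have [a [b xab]] := quad x Mx.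
have Mxa : x - a *: e \in M by rewrite memvB ?memvZ.
have xa0 : x - a *: e != 0.
  by apply: contraNneq xe => /eqP; rewrite subr_eq0 => /eqP ->; rewrite memvZ ?memv_line.
have b0 : b != 0.
  apply/eqP=> b0; move: xab; rewrite b0 expr0n /= oppr0 scale0r.
  by move=> /(minimal_ideal_domain Mxa Mxa xa0) xa; rewrite xa eqxx in xa0.
have [j Mj jj] : exists2 j, j \in M & [lie J j, j] = - e.
  exists (b^-1 *: (x - a *: e)); first by rewrite memvZ.
  rewrite 2!linearZ /= lieZl xab !scalerA -scaleN1r; congr (_ *: _).
  by field.
exists j => //; split=> //; apply/subvP=> y My.
have [c [d ycd]] := quad y My.
have [z [Mz yE zz]] : exists z,
    [/\ z \in M, y = c *: e + z & [lie J z, z] = - d ^+ 2 *: e].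
  by exists (y - c *: e); rewrite memvB ?memvZ // addrC subrK.
(* The difference of squares [z^2 - d^2 j^2] is [- d^2 e + d^2 e = 0]; without zero divisors, [z] is
   [d j] or [- d j]. *)
have zj : [lie J (z - d *: j), z + d *: j] = 0.
  rewrite !(linearD, linearN, linearZ) /= !(lieDl, lieNl, lieZl) (lieJC abJ z j) jj zz.
  by apply: eq_scalars => phi; rewrite !(linearD, linearN, linearZ, linear0) /=; ring.
rewrite {}yE.
have [/eqP|zd0] := eqVneq (z - d *: j) 0.
  by rewrite subr_eq0 => /eqP ->; rewrite memv_add ?memvZ ?memv_line.
have Mzj a' : z + a' *: j \in M by rewrite memvD ?memvZ.
have Mzd : z - d *: j \in M by rewrite -scaleNr.
have /eqP := minimal_ideal_domain Mzd (Mzj d) zd0 zj.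
by rewrite addr_eq0 -scaleNr => /eqP->; rewrite memv_add ?memvZ ?memv_line.
Qed.

End MinimalIdeal.
End Blocks.

(** * Orthogonal decomposition into fields *)

Definition fcons n T (x : T) (f : 'I_n -> T) (i : 'I_n.+1) : T :=
  oapp f x (unlift ord0 i).

Lemma fcons0 n T (x : T) (f : 'I_n -> T) : fcons x f ord0 = x.
Proof. by rewrite /fcons unlift_none. Qed.

Lemma fconsS n T (x : T) (f : 'I_n -> T) i : fcons x f (lift ord0 i) = f i.
Proof. by rewrite /fcons liftK. Qed.

Lemma forall_fcons n (P : 'I_n.+1 -> Prop) :
  P ord0 -> (forall i, P (lift ord0 i)) -> forall i, P i.
Proof. by move=> P0 PS i; case: (unliftP ord0 i) => [j|] ->. Qed.

Section BlockSystems.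
Variables (R : rcfType) (L : lieAlgType R) (J : 'End(L)).
Implicit Types (x y z : L) (K M N : {vspace L}).
Hypothesis abJ : abelian_complex_structure J.
Hypothesis J_ss : J_semisimple J.
Local Notation A := (lie_vs {:L}%VS {:L}%VS).

(** For the product [[J x, y]] on [A], [u] is an idempotent with [u * A] the real line it spans, and
    [rho] restricts on [A] to the associated character. *)
Definition real_block u (rho : 'Hom(L, R^o)) :=
  [/\ u != 0, [lie J u, u] = u & {in A, forall x, [lie J u, x] = rho x *: u}].

Definition complex_block v w (sigma tau : 'Hom(L, R^o)) :=
  [/\ v != 0, [lie J v, v] = v, [lie J v, w] = w, [lie J w, w] = - v &
      {in A, forall x, [lie J v, x] = (sigma x : R) *: v + (tau x : R) *: w}].

(* [u i] and [v k] are the units of the real and complex factors of [K], [w k] is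
   an imaginary unit of the [k]-th complex factor, and [rho], [sigma], [tau] give
   the coordinates in these factors. *)
Record block_system K p q (u : 'I_p -> L) (rho : 'I_p -> 'Hom(L, R^o))
    (v w : 'I_q -> L) (sigma tau : 'I_q -> 'Hom(L, R^o)) (e : L) := BlockSystem {
  real_blockP : forall i, real_block (u i) (rho i);
  complex_blockP : forall k, complex_block (v k) (w k) (sigma k) (tau k);
  real_block_mem : forall i, u i \in K;
  complex_block_mem : forall k, v k \in K /\ w k \in K;
  real_block_orth : forall i j, i != j -> [lie J (u i), u j] = 0;
  complex_block_orth : forall k l, k != l -> [lie J (v k), v l] = 0;
  mixed_block_orth : forall i k, [lie J (u i), v k] = 0;
  block_complete : forall x, x \in K -> (forall i, rho i x = 0) ->
    (forall k, sigma k x = 0 /\ tau k x = 0) -> x = 0;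
  block_unit_mem : e \in K;
  block_unit : forall x, x \in K -> [lie J e, x] = x
}.

Lemma real_block_line u : u \in A -> u != 0 -> [lie J u, u] = u ->
  {in A, forall x, [lie J u, x] \in <[u]>%VS} -> exists rho, real_block u rho.
Proof.
move=> Au u0 uu uA.
pose c : L -> R^o := coord [tuple u] ord0.
have c_lin : linear c by move=> a x y; rewrite /c linearP.
pose cL : {linear L -> R^o} := HB.pack c (GRing.isLinear.Build R L R^o _ c c_lin).
exists (linfun (cL \o ad (J u))); split=> // x Ax.
rewrite lfunE /= adE /c.
have : [lie J u, x] \in <<[tuple u]>>%VS by rewrite span_seq1 uA.
by move=> /coord_span {1}->; rewrite big_ord1.
Qed.

Lemma complex_block_plane v w : v \in A -> w \in A -> v != 0 ->
  [lie J v, v] = v -> [lie J v, w] = w -> [lie J w, w] = - v ->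
  {in A, forall x, [lie J v, x] \in (<[v]> + <[w]>)%VS} ->
  exists sigma tau, complex_block v w sigma tau.
Proof.
move=> Av Aw v0 vv vw ww vA.
pose c i : L -> R^o := coord [tuple v; w] i.
have c_lin i : linear (c i) by move=> a x y; rewrite /c linearP.
pose cL i : {linear L -> R^o} :=
  HB.pack (c i) (GRing.isLinear.Build R L R^o _ (c i) (c_lin i)).
exists (linfun (cL ord0 \o ad (J v))), (linfun (cL (lift ord0 ord0) \o ad (J v))).
split=> // x Ax; rewrite !lfunE /= !adE /c.
have : [lie J v, x] \in <<[tuple v; w]>>%VS by rewrite span_cons span_seq1 vA.
by move=> /coord_span {1}->; rewrite big_ord_recl big_ord1.
Qed.

(** * Peirce decomposition with respect to an idempotent *)

Section Extension.
Variables (K : {vspace L}) (e : L).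
Hypotheses (idK : lie_ideal K) (KA : (K <= A)%VS).
Hypotheses (Ke : e \in K) (ee : [lie J e, e] = e).
Local Notation K' := (K :&: lker (ad (J e)))%VS.
Let memKA := subvP KA.

Lemma annihilator_mem k : k \in K' -> k \in K /\ [lie J e, k] = 0.
Proof. by rewrite memv_cap memv_ker adE => /andP[-> /eqP]. Qed.

(** By associativity [k * y = k * (e * y) = (e * k) * y = 0]. *)
Lemma annihilator_mul k y :
  k \in K' -> y \in A -> [lie J e, y] = y -> [lie J k, y] = 0.
Proof.
move=> /annihilator_mem[Kk ek] Ay ey.
rewrite -ey (lieJC abJ e) (derived_mulCA abJ _ (memKA Kk) Ay) (lieJC abJ k) ek.
exact: linear0.
Qed.

(** Split [x] as [(x - e * x) + e * x]: the first part lies in [K'], where [e'] is the unit, and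
    [e'] annihilates the second. *)
Lemma extend_unit e' : e' \in K' -> {in K', forall x, [lie J e', x] = x} ->
  e' + e \in K /\ {in K, forall x, [lie J (e' + e), x] = x}.
Proof.
move=> K'e' unit'; have [Ke' ee'] := annihilator_mem K'e'.
split=> [|x Kx]; first by rewrite memvD.
have eex : [lie J e, [lie J e, x]] = [lie J e, x].
  by rewrite (lieJC abJ e x) (derived_mulCA abJ) ?memKA // ee.
have K'x : x - [lie J e, x] \in K'.
  rewrite memv_cap memv_ker adE memvB ?(ideal_mul_mem _ _ idK) //=.
  by rewrite linearD linearN /= eex subrr.
have e'x : [lie J e', [lie J e, x]] = 0.
  by apply: annihilator_mul => //; apply: derived_mem.
have := unit' _ K'x; rewrite linearD linearN /= e'x oppr0 addr0 => xE.
by rewrite linearD /= lieDl xE subrK.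
Qed.

Lemma extend_complete x : x \in K -> [lie J e, x] = 0 -> x \in K'.
Proof. by move=> Kx ex; rewrite memv_cap Kx memv_ker adE ex eqxx. Qed.

(** The new block is orthogonal to the old ones by [annihilator_mul]. If its coordinate vanishes at
    [x] then [e * x = 0], so [x] is in [K'] and completeness there applies. *)
Lemma extend_real p q u rho v w sigma tau e' r :
  real_block e r -> @block_system K' p q u rho v w sigma tau e' ->
  block_system K (fcons e u) (fcons r rho) v w sigma tau (e' + e).
Proof.
move=> er [uP vP Ku Kv ou ov m compl Ke' unit'].
have [Ke1 unit1] := extend_unit Ke' unit'.
have Ae := memKA Ke.
split=> //.
- by apply: forall_fcons => [|i]; rewrite ?fcons0 ?fconsS.
- apply: forall_fcons => [|i]; rewrite ?fcons0 ?fconsS //.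
  by have [] := annihilator_mem (Ku i).
- by move=> k; have [/annihilator_mem[? _] /annihilator_mem[? _]] := Kv k.
- apply: forall_fcons => [|i]; apply: forall_fcons => [|j].
  + by rewrite eqxx.
  + by rewrite fcons0 fconsS; have [] := annihilator_mem (Ku j).
  + by rewrite fcons0 fconsS annihilator_mul.
  + by rewrite !fconsS (inj_eq (@lift_inj _ _)); apply: ou.
- move=> i k; move: i; apply: forall_fcons => [|i]; last by rewrite fconsS; apply: m.
  by rewrite fcons0; have [/annihilator_mem[_ ->] _] := Kv k.
- move=> x Kx r0 c0; apply: compl => //; last first.
    by move=> i; have := r0 (lift ord0 i); rewrite fconsS.
  apply: extend_complete => //; have [_ _ ->] := er; last exact: memKA.
  by have := r0 ord0; rewrite fcons0 => ->; rewrite scale0r.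
Qed.

Lemma extend_complex p q u rho v w sigma tau e' j s t :
  j \in K ->
  complex_block e j s t -> @block_system K' p q u rho v w sigma tau e' ->
  block_system K u rho (fcons e v) (fcons j w) (fcons s sigma) (fcons t tau)
    (e' + e).
Proof.
move=> Kj er [uP vP Ku Kv ou ov m compl Ke' unit'].
have [Ke1 unit1] := extend_unit Ke' unit'.
have Ae := memKA Ke.
split=> //.
- by apply: forall_fcons => [|i]; rewrite ?fcons0 ?fconsS.
- by move=> i; have [] := annihilator_mem (Ku i).
- apply: forall_fcons => [|k]; rewrite ?fcons0 ?fconsS //.
  by have [/annihilator_mem[? _] /annihilator_mem[? _]] := Kv k.
- apply: forall_fcons => [|i]; apply: forall_fcons => [|k].
  + by rewrite eqxx.
  + by rewrite fcons0 fconsS; have [/annihilator_mem[_ ?] _] := Kv k.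
  + by rewrite fcons0 fconsS annihilator_mul //; have [] := Kv i.
  + by rewrite !fconsS (inj_eq (@lift_inj _ _)); apply: ov.
- move=> i; apply: forall_fcons => [|k]; last by rewrite fconsS; apply: m.
  by rewrite fcons0; apply: annihilator_mul.
- move=> x Kx r0 c0; apply: compl => //; last first.
    by move=> i; have := c0 (lift ord0 i); rewrite !fconsS.
  apply: extend_complete => //; have [_ _ _ _ ->] := er; last exact: memKA.
  by have := c0 ord0; rewrite !fcons0 => -[-> ->]; rewrite !scale0r addr0.
Qed.

End Extension.

(** Induction on the dimension: the unit [e] of a minimal ideal of [K] splits off one block, and its
    annihilator [K'] in [K] is a smaller ideal because [e] is not in it. *)
Lemma ex_block_system K : lie_ideal K -> (K <= A)%VS ->
  exists p q u rho v w sigma tau e, @block_system K p q u rho v w sigma tau e.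
Proof.
have [n] := ubnP (\dim K); elim: n K => // n IH K ltKn idK KA.
have [K0|K0] := eqVneq K 0%VS.
  exists 0, 0, (fun=> 0), (fun=> 0), (fun=> 0), (fun=> 0), (fun=> 0), (fun=> 0), 0.
  split; try by case.
  - by move=> x; rewrite K0 memv0 => /eqP.
  - exact: mem0v.
  - by move=> x; rewrite K0 memv0 => /eqP->; rewrite linear0.
have [M MK minM] := ex_minimal_ideal idK K0.
have MA := subv_trans MK KA; have memMA := subvP MA.
have [e [Me e0 e_unit]] := minimal_ideal_unit abJ J_ss MA minM.
have Ke := subvP MK e Me; have ee := e_unit e Me.
pose K' := (K :&: lker (ad (J e)))%VS.
have [|||p [q [u [rho [v [w [sigma [tau [e' sysK']]]]]]]]] := IH K'.
- rewrite ltnS in ltKn; apply: leq_trans ltKn.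
  rewrite ltn_neqAle dimvS ?capvSl // andbT (dimv_leqif_eq (capvSl _ _)).
  apply: contra_neq e0 => eK'; have : e \in K' by rewrite [K']eK'.
  by rewrite memv_cap memv_ker adE ee => /andP[_ /eqP].
- by apply: ideal_ker => //; apply: memMA.
- exact: subv_trans (capvSl _ _) KA.
(* The block must absorb products with all of [A], not only with [M]; this holds because [M] is an
   ideal. *)
have eM x : [lie J e, x] \in M.
  by rewrite (lieJC abJ); apply: ideal_mul_mem => //; case: minM.
have [Me1|[j Mj [jj Mej]]] := minimal_ideal_RC abJ MA minM Me e_unit.
  have [r er] : exists r, real_block e r.
    by apply: real_block_line; rewrite ?memMA // => x _; rewrite (subvP Me1).
  exists p.+1, q; do 7!eexists; exact: (extend_real idK KA Ke ee er sysK').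
have [s [t est]] : exists s t, complex_block e j s t.
  by apply: complex_block_plane; rewrite ?memMA ?e_unit // => x _; rewrite (subvP Mej).
exists p, q.+1; do 7!eexists.
exact: (extend_complex idK KA Ke ee (subvP MK j Mj) est sysK').
Qed.

End BlockSystems.

(** * Isomorphism with a sum of affine algebras *)

Section Structure.
Variables (R : rcfType) (L : lieAlgType R) (J : 'End(L)).
Implicit Types (x y z : L).
Hypothesis abJ : abelian_complex_structure J.
Hypothesis J_ss : J_semisimple J.
Local Notation A := (lie_vs {:L}%VS {:L}%VS).

(** * The unit of the derived algebra and the splitting into [A] and [J A] *)

Section Unit.
Variable e : L.
Hypotheses (Ae : e \in A) (e_unit : {in A, forall x, [lie J e, x] = x}).

(** Such elements form a [J]-invariant subspace [C]. An element commuting with [e] commutes with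
    [A = A * e]; expanding [[x, c] = [J e, [x, c]]] then shows that [C] is central, so it is a
    [J]-solvable ideal. *)
Lemma centralizer_unit z : [lie z, e] = 0 -> [lie J z, e] = 0 -> z = 0.
Proof.
pose C := (lker (ad e) :&: lker (ad e \o J))%VS.
have CE c : (c \in C) = ([lie c, e] == 0) && ([lie J c, e] == 0).
  by rewrite memv_cap !memv_ker comp_lfunE !adE !(lieC e) !oppr_eq0.
have ce0 c a : a \in A -> [lie c, e] = 0 -> [lie c, a] = 0.
  move=> Aa ce; rewrite -(e_unit Aa) (lieJC abJ) (derived_ad_mulC abJ) //.
  by rewrite ce linear0.
have C_central c x : c \in C -> [lie x, c] = 0.
  rewrite CE => /andP[/eqP ce /eqP Jce].
  rewrite -(e_unit (derived_mem x c)) lieRA (lieC _ c) ce0 ?derived_mem //.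
  rewrite (lieJl abJ e c) (lieC e) (ce0 (J c) e) //.
  by rewrite !(oppr0, lie0l, subr0).
move=> ze Jze; apply/eqP; rewrite -memv0; suff <- : C = 0%VS.
  by rewrite CE ze Jze eqxx.
apply: J_ss.
- by apply/lie_idealP=> x c Cc; rewrite C_central ?mem0v.
- apply/subvP=> x /memv_imgP[c]; rewrite !CE => /andP[ce Jce] ->.
  by rewrite Jce (JK abJ) lieNl oppr_eq0.
- exists 1%N => /=; suff -> : lie_vs C C = 0%VS by rewrite limg0 addv0.
  apply/eqP; rewrite -subv0; apply/lie_vsP=> x c _ Cc.
  by rewrite C_central ?mem0v.
Qed.

(** The difference of the two sides satisfies both conditions of [centralizer_unit], because [[a, e]
    = 0] and [[J a, e] = a] for [a] in [A]. *)
Lemma unit_decomposition z : z = [lie J z, e] + J [lie z, e].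
Proof.
apply/eqP; rewrite -subr_eq0; apply/eqP.
have eK x y : [lie J [lie x, y], e] = [lie x, y].
  by rewrite (lieJC abJ) e_unit ?derived_mem.
have e0 x y : [lie [lie x, y], e] = 0 by rewrite (derived_lie0 abJ) ?derived_mem.
by apply: centralizer_unit; rewrite !(linearD, linearN) /= ?(JK abJ);
   rewrite !(lieDl, lieNl) !eK !e0 ?oppr0 ?opprK ?addr0 ?add0r subrr.
Qed.

(** For [x = a + J b] and [y = a' + J b'] this reads [[x, y] = b * a' - b' * a], so the product on
    [A] determines the bracket. *)
Lemma lie_unit_decomposition x y : [lie x, y] =
  [lie J [lie x, e], [lie J y, e]] - [lie J [lie y, e], [lie J x, e]].
Proof.
rewrite {1}(unit_decomposition x) {1}(unit_decomposition y).
rewrite !(lieDl, linearD) /= (lieJJ abJ) !(derived_abelian abJ).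
by rewrite add0r addr0 addrC (lieC _ (J _)).
Qed.

End Unit.

(** Compare the coefficients of [u] in [u * (x * y) = x * (u * y)]. *)
Lemma real_block_mul u rho x y : u \in A -> real_block J u rho ->
  x \in A -> y \in A -> rho [lie J x, y] = (rho x : R) * rho y.
Proof.
move=> Au [u0 _ uA] Ax Ay; apply/eqP; rewrite -subr_eq0.
apply: contraTT u0 => h; rewrite negbK -[_ == 0]orFb -(negPf h) -scaler_eq0.
rewrite scalerBl -uA ?derived_mem // (derived_mulCA abJ) // uA // linearZ /=.
by rewrite (lieJC abJ) uA // scalerA mulrC subrr.
Qed.

(** Multiplying [a v + b w] by its conjugate [a v - b w] gives [(a ^+ 2 + b ^+ 2) *: v]. *)
Lemma complex_block_free v w sigma tau (a b : R) : w \in A ->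
  complex_block J v w sigma tau -> a *: v + b *: w = 0 -> a = 0 /\ b = 0.
Proof.
move=> Aw [v0 vv vw ww _] ab.
have : [lie J w, a *: v + b *: w] = 0 by rewrite ab linear0.
rewrite linearD !linearZ /= ww (lieJC abJ) vw => ba.
have : (a ^+ 2 + b ^+ 2) *: v = a *: (a *: v + b *: w) - b *: (a *: w + b *: - v).
  by apply: eq_scalars => phi; rewrite !(linearD, linearN, linearZ) /=; ring.
rewrite ab ba !scaler0 subr0 => /eqP; rewrite scaler_eq0 (negPf v0) orbF.
by rewrite paddr_eq0 ?sqr_ge0 // !sqrf_eq0 => /andP[/eqP-> /eqP->].
Qed.

Lemma complex_block_mul v w sigma tau x y : v \in A -> w \in A ->
  complex_block J v w sigma tau -> x \in A -> y \in A ->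
  sigma [lie J x, y] = (sigma x : R) * sigma y - (tau x : R) * tau y /\
  tau [lie J x, y] = (sigma x : R) * tau y + (tau x : R) * sigma y.
Proof.
move=> Av Aw blk Ax Ay; have [v0 vv vw ww vA] := blk.
have xw : [lie J x, w] = (sigma x : R) *: w - (tau x : R) *: v.
  rewrite -{1}vw (lieJC abJ v) (derived_mulCA abJ) // (lieJC abJ x) vA //.
  by rewrite linearD !linearZ /= ww (lieJC abJ w) vw scalerN.
have := vA _ (derived_mem (J x) y).
rewrite (derived_mulCA abJ) // vA // linearD !linearZ /= xw (lieJC abJ x) vA //.
set s := sigma [lie J x, y]; set t := tau [lie J x, y] => h.
suff [] : (s : R) - (sigma x * sigma y - tau x * tau y) = 0 /\
          (t : R) - (sigma x * tau y + tau x * sigma y) = 0.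
  by move=> /eqP + /eqP; rewrite !subr_eq0 => /eqP + /eqP.
apply: (complex_block_free Aw blk).
rewrite !scalerBl addrACA -h.
by apply: eq_scalars => phi; rewrite !(linearD, linearN, linearZ, linear0) /=; ring.
Qed.

(** * Coordinates from a block system *)

Section Isomorphism.
Variables (p q : nat) (u : 'I_p -> L) (rho : 'I_p -> 'Hom(L, R^o)).
Variables (v w : 'I_q -> L) (sigma tau : 'I_q -> 'Hom(L, R^o)) (e : L).
Hypothesis sys : block_system J A u rho v w sigma tau e.

(** By [unit_decomposition], [[J z, e]] and [J [z, e]] are the components of [z] in [A] and [J A].
    The former yields the coordinates along [X] and [Y], while [[z, e]] yields those along [J X] and
    [J Y]. *)
Definition block_coords z : aff_sum R p q :=
  ([ffun i => (rho i [lie J z, e], rho i [lie z, e]) : affR R],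
   [ffun k => (sigma k [lie J z, e], sigma k [lie z, e],
               tau k [lie J z, e], tau k [lie z, e]) : affC R]).

Fact block_coords_linear : linear block_coords.
Proof.
move=> a x y; congr (_, _); apply/ffunP=> i; rewrite !ffunE;
  by rewrite !linearP /= !lie_linear_l !linearP.
Qed.

HB.instance Definition _ := GRing.isLinear.Build R L (aff_sum R p q) _
  block_coords block_coords_linear.

Definition block_comb (c : 'I_p -> R) (s t : 'I_q -> R) : L :=
  \sum_i c i *: u i + \sum_k (s k *: v k + t k *: w k).

Lemma block_comb_mem c s t : block_comb c s t \in A.
Proof.
rewrite /block_comb memvD ?memv_suml // => [i _|k _].
  by rewrite memvZ ?(real_block_mem sys).
by have [? ?] := complex_block_mem sys k; rewrite memvD ?memvZ.
Qed.

Lemma rho_block_comb c s t i : rho i (block_comb c s t) = c i.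
Proof.
have [u0 uu uA] := real_blockP sys i.
have uv k : [lie J (u i), v k] = 0 := mixed_block_orth sys i k.
(* Since [w k = v k * w k], annihilating [v k] suffices. *)
have uw k : [lie J (u i), w k] = 0.
  have [_ _ <- _ _] := complex_blockP sys k.
  have [? ?] := complex_block_mem sys k.
  rewrite (lieJC abJ (v k)) (derived_mulCA abJ) ?(real_block_mem sys) //.
  by rewrite uv linear0.
have := uA _ (block_comb_mem c s t).
rewrite /block_comb linearD !linear_sum (bigD1 i) //= linearZ /= uu big1 => [|j ji].
  rewrite big1 => [|k _]; last by rewrite linearD !linearZ /= uv uw !scaler0 addr0.
  rewrite !addr0 => /eqP; rewrite -subr_eq0 -scalerBl scaler_eq0 (negPf u0) orbF.
  by rewrite subr_eq0 => /eqP <-.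
by rewrite linearZ /= (real_block_orth sys) ?scaler0 // eq_sym.
Qed.

Lemma sigma_tau_block_comb c s t k :
  sigma k (block_comb c s t) = s k /\ tau k (block_comb c s t) = t k.
Proof.
have blk := complex_blockP sys k; have [v0 vv vw ww vA] := blk.
have [Av Aw] := complex_block_mem sys k.
have vu i : [lie J (v k), u i] = 0 by rewrite (lieJC abJ) (mixed_block_orth sys).
have vv' l : l != k -> [lie J (v k), v l] = 0.
  by move=> lk; rewrite (complex_block_orth sys) // eq_sym.
have vw' l : l != k -> [lie J (v k), w l] = 0.
  move=> lk; have [_ _ <- _ _] := complex_blockP sys l.
  have [? ?] := complex_block_mem sys l.
  by rewrite (lieJC abJ (v l)) (derived_mulCA abJ) // vv' // linear0.
have := vA _ (block_comb_mem c s t).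
rewrite {1}/block_comb linearD !linear_sum big1 => [|i _]; last first.
  by rewrite linearZ /= vu scaler0.
rewrite (bigD1 k) //= big1 => [|l lk]; last first.
  by rewrite linearD !linearZ /= vv' // vw' // !scaler0 addr0.
rewrite add0r addr0 linearD !linearZ /= vv vw => h.
set s' := sigma k _; set t' := tau k _.
suff [] : (s' : R) - s k = 0 /\ (t' : R) - t k = 0.
  by move=> /eqP + /eqP; rewrite !subr_eq0 => /eqP + /eqP.
apply: (complex_block_free Aw blk).
by rewrite !scalerBl addrACA -h -opprD subrr.
Qed.

Lemma block_coordsE a b : a \in A -> b \in A -> block_coords (a + J b) =
  ([ffun i => (rho i a, rho i b) : affR R],
   [ffun k => (sigma k a, sigma k b, tau k a, tau k b) : affC R]).
Proof.
move=> Aa Ab; have [Ae e_unit] := (block_unit_mem sys, block_unit sys).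
rewrite /block_coords linearD /= (JK abJ) !lieDl lieNl (derived_lie0 abJ Aa Ae).
rewrite (derived_lie0 abJ Ab Ae).
by rewrite !(lieJC abJ _ e) !e_unit // oppr0 addr0 add0r.
Qed.

Lemma block_coords_inj : injective (linfun block_coords).
Proof.
have Ae := block_unit_mem sys; have e_unit := block_unit sys.
apply/lker0P; rewrite -subv0; apply/subvP=> z; rewrite memv_ker lfunE memv0 /=.
move=> /eqP z0; rewrite (unit_decomposition Ae e_unit z).
have zR i := congr1 (fun X : aff_sum R p q => X.1 i) z0.
have zC k := congr1 (fun X : aff_sum R p q => X.2 k) z0.
have rR i : rho i [lie J z, e] = 0 /\ rho i [lie z, e] = 0.
  by have := zR i; rewrite !ffunE => -[].
have sC k : [/\ sigma k [lie J z, e] = 0, sigma k [lie z, e] = 0,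
     tau k [lie J z, e] = 0 & tau k [lie z, e] = 0].
  by have := zC k; rewrite !ffunE => -[].
have [-> ->] : [lie J z, e] = 0 /\ [lie z, e] = 0.
  split; apply: (block_complete sys); rewrite ?derived_mem // => i;
    by [have [] := rR i | have [] := sC i].
by rewrite linear0 addr0.
Qed.

Lemma block_coords_bij : bijective (linfun block_coords).
Proof.
pose G (X : aff_sum R p q) :=
  block_comb (fun i => (X.1 i).1) (fun k => (X.2 k).1.1.1) (fun k => (X.2 k).1.2) +
  J (block_comb (fun i => (X.1 i).2) (fun k => (X.2 k).1.1.2) (fun k => (X.2 k).2)).
have GK : cancel G (linfun block_coords).
  move=> X; rewrite lfunE /= block_coordsE ?block_comb_mem //.
  case: X => XR XC; congr (_, _); apply/ffunP=> i; rewrite ffunE.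
    by rewrite !rho_block_comb /=; case: (XR i).
  have [-> ->] := sigma_tau_block_comb (fun i => (XR i).1)
    (fun k => (XC k).1.1.1) (fun k => (XC k).1.2) i.
  have [-> ->] := sigma_tau_block_comb (fun i => (XR i).2)
    (fun k => (XC k).1.1.2) (fun k => (XC k).2) i.
  by case: (XC i) => [[[]]].
exists G => // z; apply: block_coords_inj.
exact: GK.
Qed.

Lemma holomorphic_block_coords :
  holomorphic_lie_iso J (aff_sum_J R p q) (linfun block_coords).
Proof.
have Ae := block_unit_mem sys; have e_unit := block_unit sys.
have dec := unit_decomposition Ae e_unit.
split=> [|x y|x]; rewrite ?lfunE /=.
- exact: block_coords_bij.
(* The bracket lies in [A]; writing it as [a + J 0] lets [block_coordsE] apply. *)
- rewrite (lie_unit_decomposition Ae e_unit) -[X in block_coords X]addr0.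
  rewrite -(linear0 J) block_coordsE ?mem0v ?memvB ?derived_mem //.
  have [ax bx] := (derived_mem (J x) e, derived_mem x e).
  have [ay by'] := (derived_mem (J y) e, derived_mem y e).
  congr (_, _); apply/ffunP=> i; rewrite !ffunE !linearB !linear0 /=.
    have mul := real_block_mul (real_block_mem sys i) (real_blockP sys i).
    by rewrite (mul _ _ bx ay) (mul _ _ by' ax); congr (_, _); coord_ring.
  have [Av Aw] := complex_block_mem sys i.
  have [-> ->] := complex_block_mul Av Aw (complex_blockP sys i) bx ay.
  have [-> ->] := complex_block_mul Av Aw (complex_blockP sys i) by' ax.
  by congr (_, _, _, _); coord_ring.
- congr (_, _); apply/ffunP=> i; rewrite J_ffunE !ffunE lfunE /=.
    by rewrite (JK abJ) lieNl !linearN.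
  by rewrite (JK abJ) lieNl !linearN.
Qed.

End Isomorphism.

Lemma aff_classification : exists p q (f : 'Hom(L, aff_sum R p q)),
  holomorphic_lie_iso J (aff_sum_J R p q) f.
Proof.
have idA : lie_ideal A by apply/lie_idealP=> z k _; apply: derived_mem.
have [p [q [u [rho [v [w [sigma [tau [e sys]]]]]]]]] :=
  ex_block_system abJ J_ss idA (subvv _).
by exists p, q, (linfun (block_coords rho sigma tau e));
   apply: holomorphic_block_coords sys.
Qed.

End Structure.

(** * Killing forms *)

Section Trace.
Variables (F : fieldType) (L : lieAlgType F).

Lemma lftraceE (f : 'End(L)) :
  lftrace f = \sum_j coord (vbasis {:L}) j (f (vbasis {:L})`_j).
Proof.
by apply: eq_bigr => j _; rewrite mxE /= passmx.vecof_delta mxE.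
Qed.

(** Reads a trace off any expansion into maps of rank at most one, so that no matrix in the abstract
    basis [vbasis] has to be known. *)
Lemma lftrace_sum (I : finType) (phi : I -> L -> F) (v : I -> L) (f : 'End(L)) :
  (forall i, scalar (phi i)) -> (forall z, f z = \sum_i phi i z *: v i) ->
  lftrace f = \sum_i phi i (v i).
Proof.
move=> phi_lin fE; rewrite lftraceE.
under eq_bigr do rewrite fE linear_sum.
rewrite exchange_big; apply: eq_bigr => i _ /=.
pose s : {scalar L} := HB.pack (phi i) (GRing.isLinear.Build F L F _ _ (phi_lin i)).
rewrite -[phi i (v i)]/(s (v i)) [in RHS](coord_vbasis (memvf (v i))) linear_sum.
by apply: eq_bigr => j _; rewrite !linearZ /= mulrC.
Qed.

Lemma killing_coord x y : killing x y =
  \sum_j coord (vbasis {:L}) j [lie x, [lie y, (vbasis {:L})`_j]].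
Proof. by rewrite /killing lftraceE; under eq_bigr do rewrite comp_lfunE !adE. Qed.

Lemma lie_lie_coord x y z : [lie x, [lie y, z]] =
  \sum_j coord (vbasis {:L}) j z *: [lie x, [lie y, (vbasis {:L})`_j]].
Proof.
rewrite {1}(coord_vbasis (memvf z)) !linear_sum.
by apply: eq_bigr => j _; rewrite !linearZ.
Qed.

Lemma killing_sum (I : finType) (phi : I -> L -> F) (v : I -> L) x y :
  (forall i, scalar (phi i)) ->
  (forall z, [lie x, [lie y, z]] = \sum_i phi i z *: v i) ->
  killing x y = \sum_i phi i (v i).
Proof. by move=> ? xyE; apply: lftrace_sum => // z; rewrite comp_lfunE !adE xyE. Qed.

End Trace.

Lemma killing_iso (F : fieldType) (L1 L2 : lieAlgType F) (J1 : 'End(L1))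
    (J2 : 'End(L2)) (f : 'Hom(L1, L2)) x y :
  holomorphic_lie_iso J1 J2 f -> killing (f x) (f y) = killing x y.
Proof.
case=> -[g fK gK] f_lie _.
(* The coordinate forms on [L1], pulled back along [g], must be linear for [killing_sum]. *)
have g_lin : linear g.
  move=> a u v; apply: (can_inj fK).
  by rewrite [LHS]gK linearP /= [f (g u)]gK [f (g v)]gK.
rewrite [RHS]killing_coord.
rewrite (killing_sum (I := 'I_(\dim {:L1}))
  (phi := fun j z => coord (vbasis {:L1}) j (g z))
  (v := fun j => f [lie x, [lie y, (vbasis {:L1})`_j]])).
- by apply: eq_bigr => j _; rewrite fK.
- by move=> j a u v; rewrite g_lin linearP /=.
- move=> z; rewrite -{1}[z]gK -!f_lie lie_lie_coord linear_sum.
  by apply: eq_bigr => j _; rewrite linearZ.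
Qed.

Lemma killing_pair (F : fieldType) (L1 L2 : lieAlgType F) (x y : L1 * L2) :
  killing x y = killing x.1 y.1 + killing x.2 y.2.
Proof.
rewrite (killing_coord x.1) (killing_coord x.2).
rewrite (killing_sum (I := ('I_(\dim {:L1}) + 'I_(\dim {:L2}))%type)
  (phi := fun k z => match k with
     | inl j => coord (vbasis {:L1}) j z.1 | inr j => coord (vbasis {:L2}) j z.2 end)
  (v := fun k => match k with
     | inl j => ([lie x.1, [lie y.1, (vbasis {:L1})`_j]], 0)
     | inr j => (0, [lie x.2, [lie y.2, (vbasis {:L2})`_j]]) end)).
- by rewrite big_sumType.
- by case=> j a u v; rewrite linearP.
- move=> z; rewrite big_sumType /=.
  rewrite -[LHS]/([lie x.1, [lie y.1, z.1]], [lie x.2, [lie y.2, z.2]]).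
  rewrite !lie_lie_coord [RHS]surjective_pairing !raddfD !raddf_sum /=.
  congr (_, _).
    by rewrite [X in _ + X]big1 ?addr0 // => j _; rewrite scaler0.
  by rewrite [X in X + _]big1 ?add0r // => j _; rewrite scaler0.
Qed.

Lemma killing_ffun (F : fieldType) (L : lieAlgType F) (I : finType)
  (x y : {ffun I -> L}) : killing x y = \sum_i killing (x i) (y i).
Proof.
under eq_bigr do rewrite killing_coord.
rewrite (killing_sum (I := (I * 'I_(\dim {:L}))%type)
  (phi := fun k (z : {ffun I -> L}) => coord (vbasis {:L}) k.2 (z k.1))
  (v := fun k => [ffun i => if i == k.1
     then [lie x i, [lie y i, (vbasis {:L})`_k.2]] else 0])).
- by rewrite pair_big; apply: eq_bigr => k _; rewrite ffunE eqxx.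
- by move=> k a u v; rewrite !ffunE linearP.
- move=> z; apply/ffunP=> i; rewrite !ffunE lie_lie_coord sum_ffunE.
  rewrite -(pair_big xpredT xpredT (fun i' j => (coord (vbasis {:L}) j (z i') *:
    [ffun i => if i == i' then [lie x i, [lie y i, (vbasis {:L})`_j]] else 0 : L])
    i)) /=.
  rewrite (bigD1 i) //= [X in _ + X]big1 => [|i' ne].
    by rewrite addr0; apply: eq_bigr => j _; rewrite !ffunE eqxx.
  by rewrite big1 // => j _; rewrite !ffunE eq_sym (negPf ne) scaler0.
Qed.

Lemma killing_affR (F : fieldType) (x y : affR F) :
  killing x y = (x.2 : F) * y.2.
Proof.
rewrite (killing_sum (I := 'I_1) (v := fun=> affR_X F) (phi := fun _ (z : affR F) =>
  (x.2 : F) * ((y.2 : F) * z.1 - (y.1 : F) * z.2))).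
- by rewrite big_ord1 /=; ring.
- by move=> _ a u v /=; rewrite ?regular_scaleE; ring.
- by move=> z; rewrite big_ord1; congr (_, _); coord_ring.
Qed.

(** This is twice the real part of [(b + i d) * (b' + i d')], the real trace of complex
    multiplication. Its indefinite sign is what the conjugation corrects. *)
Lemma killing_affC (F : fieldType) (x y : affC F) :
  killing x y = 2 * ((x.1.1.2 : F) * y.1.1.2 - (x.2 : F) * y.2).
Proof.
case: x y => [[[a b] c] d] [[[a' b'] c'] d'] /=.
(* Coordinates along [X] and [Y] of the inner bracket with [z]; the outer bracket then multiplies
   [re z + i im z] by [b + i d]. *)
pose re (z : affC F) : F := (b' * z.1.1.1 - a' * z.1.1.2) - (d' * z.1.2 - c' * z.2).
pose im (z : affC F) : F := (b' * z.1.2 - a' * z.2) + (d' * z.1.1.1 - c' * z.1.1.2).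
rewrite (killing_sum (I := 'I_2)
  (v := fun i => if i == ord0 then affC_X F else affC_Y F)
  (phi := fun i z => if i == ord0 then (b : F) * re z - (d : F) * im z
                     else (b : F) * im z + (d : F) * re z)).
- by rewrite big_ord_recl big_ord1 /= /re /im /=; ring.
- move=> i k u v; rewrite /re /im /=; case: eqP => _; rewrite ?regular_scaleE; ring.
- move=> [[[z1 z2] z3] z4]; rewrite big_ord_recl big_ord1 /re /im /=.
  by congr (_, _, _, _); coord_ring.
Qed.

(** * Conjugation and the metric *)

Section InvolutionGrading.
Variables (F : numFieldType) (L : lieAlgType F) (J s : 'End(L)).
Hypothesis s_aut : holomorphic_lie_aut J s.
Hypothesis ss : forall x, s (s x) = x.

Definition fixed_part : {vspace L} := lker (s - \1%VF).
Definition negated_part : {vspace L} := lker (s + \1%VF).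

Lemma fixed_partP x : (x \in fixed_part) = (s x == x).
Proof. by rewrite memv_ker add_lfunE opp_lfunE id_lfunE subr_eq0. Qed.

Lemma negated_partP x : (x \in negated_part) = (s x == - x).
Proof. by rewrite memv_ker add_lfunE id_lfunE addr_eq0. Qed.

Let s_lie x y : s [lie x, y] = [lie s x, s y]. Proof. by case: s_aut. Qed.
Let s_J x : s (J x) = J (s x). Proof. by case: s_aut. Qed.

Lemma fixed_part_lie : (lie_vs fixed_part fixed_part <= fixed_part)%VS.
Proof.
apply/lie_vsP=> x y; rewrite !fixed_partP s_lie => /eqP-> /eqP->.
exact: eqxx.
Qed.

Lemma fixed_negated_lie : (lie_vs fixed_part negated_part <= negated_part)%VS.
Proof.
apply/lie_vsP=> x y; rewrite fixed_partP !negated_partP s_lie => /eqP-> /eqP->.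
by rewrite linearN.
Qed.

Lemma negated_part_lie : (lie_vs negated_part negated_part <= fixed_part)%VS.
Proof.
apply/lie_vsP=> x y; rewrite fixed_partP !negated_partP s_lie => /eqP-> /eqP->.
by rewrite linearN /= lieNl opprK.
Qed.

Lemma fixed_part_J : J_invariant J fixed_part.
Proof.
apply/subvP=> y /memv_imgP[x]; rewrite !fixed_partP => /eqP sx ->.
by rewrite s_J sx.
Qed.

Lemma negated_part_J : J_invariant J negated_part.
Proof.
apply/subvP=> y /memv_imgP[x]; rewrite !negated_partP => /eqP sx ->.
by rewrite s_J sx linearN.
Qed.

Lemma add_fixed_negated : (fixed_part + negated_part)%VS = {:L}%VS.
Proof.
apply/eqP; rewrite eqEsubv subvf /=; apply/subvP=> x _.
have -> : x = 2^-1 *: (x + s x) + 2^-1 *: (x - s x).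
  rewrite -scalerDr addrACA subrr addr0 -mulr2n -scaler_nat scalerA.
  by rewrite mulVf ?pnatr_eq0 // scale1r.
rewrite memv_add ?memvZ // ?fixed_partP ?negated_partP linearD ?linearN /= ss.
  by rewrite addrC.
by rewrite opprB addrC.
Qed.

Lemma directv_fixed_negated : directv (fixed_part + negated_part).
Proof.
apply/directv_addP/eqP; rewrite -subv0; apply/subvP=> x.
rewrite memv_cap fixed_partP negated_partP => /andP[/eqP->].
by rewrite -addr_eq0 -mulr2n -scaler_nat scaler_eq0 pnatr_eq0 memv0.
Qed.

End InvolutionGrading.

(** * The conjugation and its metric on the model *)

Section AffConjugation.
Variables (R : realFieldType) (p q : nat).
Local Notation V := (aff_sum R p q).
Implicit Types X Y Z : V.

Lemma killing_aff_sum X Y : killing X Y =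
  \sum_i ((X.1 i).2 : R) * (Y.1 i).2 +
  \sum_k 2 * (((X.2 k).1.1.2 : R) * (Y.2 k).1.1.2 - ((X.2 k).2 : R) * (Y.2 k).2).
Proof.
rewrite [LHS]killing_pair !killing_ffun.
by congr (_ + _); apply: eq_bigr => i _; rewrite ?killing_affR ?killing_affC.
Qed.

(** Reading [(a, b, c, d)] as the complex pair [a + i c], [b + i d], this is entrywise
    conjugation. *)
Definition aff_conj_fun X : V :=
  (X.1, [ffun k => ((X.2 k).1.1.1, (X.2 k).1.1.2, - (X.2 k).1.2, - (X.2 k).2)
           : affC R]).

Fact aff_conj_linear : linear aff_conj_fun.
Proof.
move=> a X Y; congr (_, _); apply/ffunP=> k; rewrite !ffunE.
by congr (_, _, _, _); coord_ring.
Qed.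

HB.instance Definition _ :=
  GRing.isLinear.Build R V V _ aff_conj_fun aff_conj_linear.

Definition aff_conj : 'End(V) := linfun aff_conj_fun.

Lemma aff_conjE X : aff_conj X = aff_conj_fun X. Proof. by rewrite lfunE. Qed.

Lemma aff_conjK X : aff_conj (aff_conj X) = X.
Proof.
rewrite !aff_conjE [RHS]surjective_pairing; congr (_, _); apply/ffunP=> k.
by rewrite !ffunE /= !opprK; case: (X.2 k) => [[[]]].
Qed.

Lemma aff_conj_aut : holomorphic_lie_aut (aff_sum_J R p q) aff_conj.
Proof.
split=> [|X Y|X]; first by exists aff_conj; apply: aff_conjK.
- rewrite !aff_conjE; congr (_, _); apply/ffunP=> k; rewrite !ffunE /=.
  case: (X.2 k) (Y.2 k) => [[[a b] c] d] [[[a' b'] c'] d'].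
  by congr (_, _, _, _); coord_ring.
- rewrite !aff_conjE !J_pairE; congr (_, _); apply/ffunP=> k.
  rewrite /= J_ffunE !ffunE J_ffunE !lfunE /=.
  case: (X.2 k) => [[[a b] c] d].
  by congr (_, _, _, _); coord_ring.
Qed.

Definition aff_metric X Y : R :=
  2^-1 * (\sum_i (((X.1 i).1 : R) * (Y.1 i).1 + ((X.1 i).2 : R) * (Y.1 i).2) +
    \sum_k 2 * (((X.2 k).1.1.1 : R) * (Y.2 k).1.1.1 + ((X.2 k).1.1.2 : R) * (Y.2 k).1.1.2
     + ((X.2 k).1.2 : R) * (Y.2 k).1.2 + ((X.2 k).2 : R) * (Y.2 k).2)).

(** The Killing form sees only coordinates along [J X] and [J Y]; its value on [J]-images supplies
    those along [X] and [Y], and the conjugation makes all signs positive. *)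
Lemma killing11_aff_conj X Y :
  killing11_twist (aff_sum_J R p q) aff_conj X Y = aff_metric X Y.
Proof.
rewrite /killing11_twist /killing11 !killing_aff_sum /aff_metric; congr (_ * _).
rewrite addrACA -!big_split /= aff_conjE; congr (_ + _); apply: eq_bigr => i _.
  rewrite !J_pairE !J_ffunE !lfunE /=; ring.
rewrite !J_pairE !J_ffunE !lfunE /= !ffunE.
by case: (X.2 i) (Y.2 i) => [[[a b] c] d] [[[a' b'] c'] d'] /=; ring.
Qed.

Lemma aff_metricC X Y : aff_metric X Y = aff_metric Y X.
Proof.
by congr (_ * (_ + _)); apply: eq_bigr => i _; ring.
Qed.

Lemma aff_metric_linear X : scalar (aff_metric X).
Proof.
move=> a Y Z; rewrite /aff_metric mulrCA -mulrDr; congr (_ * _).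
rewrite mulrDr !mulr_sumr addrACA -!big_split /=.
by congr (_ + _); apply: eq_bigr => i _; rewrite !ffunE /= ?regular_scaleE; ring.
Qed.

Lemma aff_metric_gt0 X : X != 0 -> 0 < aff_metric X X.
Proof.
move=> X0; rewrite pmulr_rgt0 ?invr_gt0 ?ltr0n // lt_def.
have r_ge0 i : 0 <= ((X.1 i).1 : R) * (X.1 i).1 + ((X.1 i).2 : R) * (X.1 i).2.
  by nra.
have c_ge0 k : 0 <= 2 * (((X.2 k).1.1.1 : R) * (X.2 k).1.1.1 +
    ((X.2 k).1.1.2 : R) * (X.2 k).1.1.2
    + ((X.2 k).1.2 : R) * (X.2 k).1.2 + ((X.2 k).2 : R) * (X.2 k).2).
  by nra.
rewrite addr_ge0 ?sumr_ge0 // andbT paddr_eq0 ?sumr_ge0 //.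
apply: contra X0 => /andP[]; rewrite !psumr_eq0 // => /allP r0 /allP c0.
apply/eqP; rewrite [LHS]surjective_pairing; congr (_, _); apply/ffunP=> i; rewrite ffunE.
  have := r0 i (mem_index_enum _); case: (X.1 i) => a b /= /eqP h.
  by congr (_, _); apply/eqP; rewrite -sqrf_eq0; apply/eqP; nra.
have := c0 i (mem_index_enum _); case: (X.2 i) => [[[a b] c] d] /= /eqP h.
by congr (_, _, _, _); apply/eqP; rewrite -sqrf_eq0; apply/eqP; nra.
Qed.

Lemma aff_metric_J X Y :
  aff_metric (aff_sum_J R p q X) (aff_sum_J R p q Y) = aff_metric X Y.
Proof.
congr (_ * (_ + _)); apply: eq_bigr => i _; rewrite !J_pairE !J_ffunE !lfunE /=.
  ring.
by case: (X.2 i) (Y.2 i) => [[[a b] c] d] [[[a' b'] c'] d'] /=; ring.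
Qed.

(* Membership in the derived algebra. *)
Definition aff_real X :=
  (forall i, (X.1 i).2 = 0) /\ forall k, (X.2 k).1.1.2 = 0 /\ (X.2 k).2 = 0.

(** For such [X], [ad (J X)] is zero on the [J X], [J Y] coordinates and multiplication by [X] on
    the others; the adjoint of multiplication by a complex number is multiplication by its
    conjugate. *)
Lemma aff_metric_adjoint X Y Z : aff_real X ->
  aff_metric [lie aff_sum_J R p q X, Y] Z =
  aff_metric Y [lie aff_sum_J R p q (aff_conj X), Z].
Proof.
case=> rX cX; rewrite aff_conjE !J_pairE.
congr (_ * (_ + _)); apply: eq_bigr => i _; rewrite /= !ffunE !J_ffunE !lfunE /=.
  by rewrite rX; ring.
rewrite !ffunE; have [] := cX i.
case: (X.2 i) (Y.2 i) (Z.2 i) => [[[a b] c] d] [[[a1 b1] c1] d1] [[[a2 b2] c2] d2] /=.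
by move=> -> ->; ring.
Qed.

Definition aff_one : V := ([ffun=> affR_X R], [ffun=> affC_X R]).

(** Presents [aff_real] as the kernel of a linear map, so that in [derived_aff_real] it passes from
    brackets to their span. *)
Lemma aff_one_realP X : [lie aff_one, X] = 0 <-> aff_real X.
Proof.
split=> [h|[rX cX]].
  split=> k.
    have := congr1 (fun Z : V => (Z.1 k).1) h; rewrite /= !ffunE /=.
    by rewrite mul0r mul1r sub0r => e; apply: oppr_inj; rewrite oppr0; apply: e.
  have := congr1 (fun Z : V => (Z.2 k).1.1.1) h.
  have := congr1 (fun Z : V => (Z.2 k).1.2) h; rewrite /= !ffunE /=.
  case: (X.2 k) => [[[a b] c] d] /=.
  rewrite !(mul0r, mul1r, add0r, addr0, subr0, sub0r, oppr0) => d0 b0.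
  by split; apply: oppr_inj; rewrite oppr0; [apply: b0 | apply: d0].
congr (_, _); apply/ffunP=> k; rewrite !ffunE.
  by case: (X.1 k) (rX k) => a b /= ->; congr (_, _); coord_ring.
have [] := cX k; case: (X.2 k) => [[[a b] c] d] /= -> ->.
by congr (_, _, _, _); coord_ring.
Qed.

Lemma aff_real_lie X Y : aff_real [lie X, Y].
Proof.
split=> [i|k]; rewrite /= !ffunE //.
by case: (X.2 k) (Y.2 k) => [[[a b] c] d] [[[a1 b1] c1] d1].
Qed.

End AffConjugation.

(** * Transport of the conjugation along the isomorphism *)

Section AffTransport.
Variables (R : realFieldType) (L : lieAlgType R) (J : 'End(L)) (p q : nat).
Variable f : 'Hom(L, aff_sum R p q).
Hypothesis f_iso : holomorphic_lie_iso J (aff_sum_J R p q) f.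

Lemma aff_iso_inj : injective f. Proof. by case: f_iso => /bij_inj. Qed.

Lemma aff_iso_lie x y : f [lie x, y] = [lie f x, f y].
Proof. by case: f_iso. Qed.

Lemma aff_iso_J x : f (J x) = aff_sum_J R p q (f x).
Proof. by case: f_iso. Qed.

Lemma aff_iso_invK : cancel f^-1%VF f.
Proof.
case: f_iso => -[g fK gK] _ _ X; rewrite -[X]gK.
by rewrite lker0_lfunK //; apply/lker0P/aff_iso_inj.
Qed.

Definition conj_transport : 'End(L) := (f^-1 \o aff_conj R p q \o f)%VF.

Lemma aff_iso_conj x : f (conj_transport x) = aff_conj R p q (f x).
Proof. by rewrite !comp_lfunE aff_iso_invK. Qed.

Lemma conj_transportK x : conj_transport (conj_transport x) = x.
Proof. by apply: aff_iso_inj; rewrite !aff_iso_conj aff_conjK. Qed.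

Lemma conj_transport_aut : holomorphic_lie_aut J conj_transport.
Proof.
have [_ c_lie c_J] := aff_conj_aut R p q.
split=> [|x y|x]; first by exists conj_transport; apply: conj_transportK.
- by apply: aff_iso_inj; rewrite !(aff_iso_conj, aff_iso_lie) c_lie.
- by apply: aff_iso_inj; rewrite !(aff_iso_conj, aff_iso_J) c_J.
Qed.

Lemma killing11_conj_transport x y :
  killing11_twist J conj_transport x y = aff_metric (f x) (f y).
Proof.
rewrite -killing11_aff_conj /killing11_twist /killing11 -aff_iso_conj.
by rewrite -!aff_iso_J !(killing_iso _ _ f_iso).
Qed.

Lemma killing11_conj_hermitian :
  hermitian_metric J (killing11_twist J conj_transport).
Proof.
split=> [x|x y|x x0|x y].
- have lin y : scalar (fun z => aff_metric (f y) (f z)).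
    by move=> a u v; rewrite linearP aff_metric_linear.
  split=> a u v; rewrite !killing11_conj_transport; first exact: lin.
  by rewrite !(aff_metricC _ (f x)); apply: lin.
- by rewrite !killing11_conj_transport aff_metricC.
- rewrite killing11_conj_transport aff_metric_gt0 //.
  by rewrite -(linear0 f) (inj_eq aff_iso_inj).
- by rewrite !killing11_conj_transport !aff_iso_J aff_metric_J.
Qed.

Lemma derived_aff_real x : x \in lie_vs fullv fullv -> aff_real (f x).
Proof.
have /subvP h : (lie_vs {:L} {:L} <= lker (ad (aff_one R p q) \o f))%VS.
  apply/lie_vsP=> u v _ _; rewrite memv_ker comp_lfunE adE aff_iso_lie.
  by apply/eqP/aff_one_realP; apply: aff_real_lie.
by move=> /h; rewrite memv_ker comp_lfunE adE => /eqP/aff_one_realP.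
Qed.

(** Both signs in the transpose formula come from this identity, by inserting [s x = x] or
    [s x = - x]. *)
Lemma conj_transport_adjoint x y z : x \in lie_vs fullv fullv ->
  killing11_twist J conj_transport [lie J x, y] z =
  killing11_twist J conj_transport y [lie J (conj_transport x), z].
Proof.
move=> /derived_aff_real fx; rewrite !killing11_conj_transport !aff_iso_lie !aff_iso_J.
by rewrite aff_metric_adjoint // aff_iso_conj.
Qed.

End AffTransport.

Theorem corollary3p11 (R : realType) (g : lieAlgType R) (J : 'End(g))
    (g_neq0 : {:g}%VS != 0%VS)
    (J_abelian : abelian_complex_structure J)
    (J_ss : J_semisimple J) :
  (exists p q : nat,
     (1 <= p + q)%N /\ holomorphic_lie_isomorphic J (aff_sum_J R p q)) /\
  (exists gp gm : {vspace g},
     [/\ lie_subalgebra gp, J_invariant J gp, J_invariant J gm,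
         (gp + gm)%VS = {:g}%VS & directv (gp + gm)] /\
     [/\ (lie_vs gp gp <= gp)%VS, (lie_vs gp gm <= gm)%VS
       & (lie_vs gm gm <= gp)%VS] /\
     exists s : 'End(g),
       [/\ {in gp, forall x, s x = x} /\ {in gm, forall x, s x = - x},
           holomorphic_lie_aut J s, (s \o s)%VF = \1%VF
         & hermitian_metric J (killing11_twist J s)] /\
       (forall x, x \in (gp :&: lie_vs fullv fullv)%VS ->
          is_transpose (killing11_twist J s) (ad (J x)) (ad (J x))) /\
       (forall x, x \in (gm :&: lie_vs fullv fullv)%VS ->
          is_transpose (killing11_twist J s) (ad (J x)) (- ad (J x)))).
Proof.
have [p [q [f f_iso]]] := aff_classification J_abelian J_ss.
split.
  exists p, q; split; last by exists f.
  (* With no summands the model is zero, and injectivity of [f] would make [g] zero. *)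
  rewrite lt0n; apply: contraNneq g_neq0 => /eqP; rewrite addn_eq0.
  move=> /andP[/eqP p0 /eqP q0]; rewrite -subv0; apply/subvP=> x _; rewrite memv0.
  apply/eqP; apply: (aff_iso_inj f_iso).
  move: {f_iso} f; rewrite p0 q0 => f.
  by case: (f x) (f 0) => [a b] [c d]; congr (_, _); apply/ffunP=> -[].
have s_aut := conj_transport_aut f_iso.
have sK := conj_transportK f_iso.
set s := conj_transport f in s_aut sK *.
exists (fixed_part s), (negated_part s); split.
  split.
  - exact: fixed_part_lie s_aut.
  - exact: fixed_part_J s_aut.
  - exact: negated_part_J s_aut.
  - exact: add_fixed_negated.
  - exact: directv_fixed_negated.
split.
  split.
  - exact: fixed_part_lie s_aut.
  - exact: fixed_negated_lie s_aut.
  - exact: negated_part_lie s_aut.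
exists s; split; [split|split].
- by split=> x; [rewrite fixed_partP | rewrite negated_partP] => /eqP.
- exact: s_aut.
- by apply/lfunP=> x; rewrite comp_lfunE id_lfunE.
- exact: killing11_conj_hermitian.
- move=> x; rewrite memv_cap fixed_partP => /andP[/eqP sx dx] y z.
  by rewrite !adE (conj_transport_adjoint f_iso) // -/s sx.
- move=> x; rewrite memv_cap negated_partP => /andP[/eqP sx dx] y z.
  (* With [y] and [z] exchanged, symmetry brings the sign of [s x = - x] into the argument carrying
     [- ad (J x)]. *)
  have h := conj_transport_adjoint f_iso z y dx.
  have [_ symm _ _] := killing11_conj_hermitian f_iso.
  rewrite opp_lfunE !adE -/s in symm h *.
  rewrite symm [in RHS]symm h -/s sx.
  by rewrite linearN /= lieNl.
Qed.
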